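(* Let $\tilde w=s_{\beta_1}\cdots s_{\beta_r}$ be an expression (not necessarily reduced) in simple reflections of the Weyl group of a Kac-Moody group $G$, with toric limit $Y_{\tilde w}$. For $1\le i\le r$ let $I_i=\tilde I_i=\{i=j_1,j_2,\dots,j_m\}$ be the index sequence, and $L_{I_i}\subset Y_{\tilde w}$ the corresponding curve, defined in the context. Then the set $\{[L_{I_i}]:1\le i\le r\}$ of classes of curves forms a basis of $N_1(Y_{\tilde w})_{\mathbb Z}$, and the class in $N_1(Y_{\tilde w})$ of every torus-invariant curve lies in the cone generated by $\{[L_{I_i}]:1\le i\le r\}$.
   Context: We work over $\mathbb C$. $G$ is a Kac-Moody group; the $\beta_i$ are simple roots and $\beta_{ij}:=\langle\beta_j,\check\beta_i\rangle$, with $\check\beta_i$ the coroot of $\beta_i$. The toric limit $Y_{\tilde w}$ (the special fibre of a toric degeneration of the Bott-Samelson-Demazure-Hansen variety $Z(\tilde w)$) is the smooth projective toric variety whose fan $\Sigma$ in $\mathbb R^r$ has as cones those generated by subsets of $\{e_1^{\pm},\dots,e_r^{\pm}\}$ containing no pair $\{e_i^+,e_i^-\}$, where $e_1^+,\dots,e_r^+$ is the standard basis of $\mathbb Z^r$ and $e_i^-:=-e_i^+-\sum_{j>i}\beta_{ij}e_j^+$. For $1\le j\le r$ let $\tilde w_j=s_{\beta_1}\cdots s_{\beta_j}$. Projection $\mathbb Z^j\to\mathbb Z^{j-1}$ onto the first $j-1$ coordinates induces a toric $\mathbb P^1$-fibration $f_j:Y_{\tilde w_j}\to Y_{\tilde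 w_{j-1}}$ ($Y_{\tilde w_0}$ a point) with two disjoint toric sections: the Schubert section, with image the toric divisor of the ray generated by $e_j^+$, and the non-Schubert section, with image the toric divisor of the ray generated by $e_j^-$. The Schubert point of $Y_{\tilde w_j}$ is the torus-fixed point of the cone generated by $e_1^+,\dots,e_j^+$; the Schubert line $L_j\subset Y_{\tilde w_j}$ is the fibre of $f_j$ over the Schubert point of $Y_{\tilde w_{j-1}}$. For $I=(i_1<\dots<i_m)$ in $\{1,\dots,r\}$, $L_I\subset Y_{\tilde w}$ is the curve obtained from the Schubert line $L_{i_1}\subset Y_{\tilde w_{i_1}}$ by applying successively, for $k=i_1+1,\dots,r$, the non-Schubert section $Y_{\tilde w_{k-1}}\to Y_{\tilde w_k}$ if $k\in I$ and the Schubert section if $k\notin I$. Definition of $\tilde I_i$: put $j_1=i$ and $a_{1,j}:=\beta_{ij}$ for $j>i$. Let $j_2>j_1$ be the least integer $\leq r$ with $a_{1,j_2}>0$ (if any), and for $j>j_2$ put $a_{2,j}:=\beta_{ij_2}\beta_{j_2j}-\beta_{ij}$. For $k>2$, let $j_k>j_{k-1}$ be the least integer $\le r$ with $a_{k-1,j_k}<0$ (if any), and for $j>j_k$ put $a_{k,j}:=-a_{k-1,j_k}\beta_{j_kj}+a_{k-1,j}$. The process stops when no such integer exists; $\tilde I_i:=\{j_1,\dots,j_m\}$ is the set of all indices produced. $N_1(X)_{\mathbb Z}$ is the group of integral 1-cycles on $X$ modulo numerical equivalence and $N_1(X)=N_1(X)_{\mathbb Z}\otimes\mathbb R$. *)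

(* Defs.v *)
From HB Require Import structures.
From mathcomp Require Import all_boot all_order all_algebra.
From mathcomp Require Import fraction boolp classical_sets reals complex mpoly.

Set Implicit Arguments.
Unset Strict Implicit.
Unset Printing Implicit Defensive.

Import Order.TTheory GRing.Theory Num.Theory.

Local Open Scope classical_set_scope.
Local Open Scope ring_scope.

(** * Toric varieties of simplicial fans

   The lattices N and M = Hom(N, Z) are both 'rV[int]_n, paired by the dot
   product. A cone is given by its set of rays, so that its faces are the
   subsets of that set. *)

Record fan (n : nat) := Fan {
  ray : finType;
  ray_gen : ray -> 'rV[int]_n;
  cones : {set {set ray}} }.

Definition lpairing (n : nat) (m u : 'rV[int]_n) : int :=
  \sum_i m 0 i * u 0 i.

Definition dual_cone (n : nat) (X : fan n) (s : {set ray X}) (m : 'rV[int]_n) :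
    bool :=
  [forall rho in s, 0 <= lpairing m (ray_gen rho)].

Definition orthogonal_cone (n : nat) (X : fan n) (s : {set ray X})
    (m : 'rV[int]_n) : bool :=
  [forall rho in s, lpairing m (ray_gen rho) == 0].

(* The closed points of the toric variety of X over k. The variety is the
   disjoint union over the cones s of the torus orbits Hom(s^perp, k^* ). A
   point of the orbit of s is the same as a semigroup morphism
   s^dual -> (k, * ) that is nonzero exactly on s^perp; [chi] is this morphism,
   extended by 0 outside s^dual. *)
Record tpoint (k : fieldType) (n : nat) (X : fan n) := TPoint {
  cone_of : {set ray X};
  chi : 'rV[int]_n -> k;
  cone_ofP : cone_of \in cones X;
  chi_neq0 : forall m, (chi m != 0) = orthogonal_cone cone_of m;
  chi0 : chi 0 = 1;
  chiD : forall m m', orthogonal_cone cone_of m -> orthogonal_cone cone_of m' ->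
    chi (m + m') = chi m * chi m' }.

(* The affine chart Spec k[s^dual]. *)
Definition chart (k : fieldType) (n : nat) (X : fan n) (s : {set ray X}) :
    set (tpoint k X) :=
  [set x | cone_of x \subset s].

(* A finite formal sum of terms c * chi^m. *)
Definition laurent (k : fieldType) (n : nat) := seq (k * 'rV[int]_n).

Definition regular (k : fieldType) (n : nat) (X : fan n) (s : {set ray X})
    (a : laurent k n) : bool :=
  all (fun t => dual_cone s t.2) a.

(* Meaningful only for x in a chart on which a is regular. *)
Definition eval (k : fieldType) (n : nat) (X : fan n) (a : laurent k n)
    (x : tpoint k X) : k :=
  \sum_(t <- a) t.1 * chi x t.2.

(** ** Zariski topology, curves and the torus action *)

Definition zariski_closed (k : fieldType) (n : nat) (X : fan n)
    (Z : set (tpoint k X)) : Prop :=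
  forall s, s \in cones X ->
    exists2 F : set (laurent k n), (forall a, F a -> regular s a) &
      forall x, chart s x -> (Z x <-> forall a, F a -> eval a x = 0).

Definition irreducible_closed (k : fieldType) (n : nat) (X : fan n)
    (Z : set (tpoint k X)) : Prop :=
  [/\ zariski_closed Z, Z !=set0 &
    forall A B, zariski_closed A -> zariski_closed B -> Z `<=` A `|` B ->
      Z `<=` A \/ Z `<=` B].

(* Irreducible closed subsets of Krull dimension 1. *)
Definition is_curve (k : fieldType) (n : nat) (X : fan n)
    (Z : set (tpoint k X)) : Prop :=
  [/\ irreducible_closed Z,
      exists2 Z0, irreducible_closed Z0 & Z0 `<` Z &
      forall Z0 Z1, irreducible_closed Z0 -> irreducible_closed Z1 ->
        Z0 `<` Z1 -> ~ (Z1 `<` Z)].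

Record curve (k : fieldType) (n : nat) (X : fan n) := Curve {
  carrier :> set (tpoint k X);
  curveP : is_curve carrier }.

(* The torus is Hom(M, k^* ), a morphism being given by its values c on the
   standard basis of M; y below is the translate of x by c. *)
Definition torus_invariant (k : fieldType) (n : nat) (X : fan n)
    (Z : set (tpoint k X)) : Prop :=
  forall (c : 'I_n -> k), (forall i, c i != 0) ->
  forall x y : tpoint k X, cone_of y = cone_of x ->
    (forall m, chi y m = (\prod_i c i ^ m 0 i) * chi x m) ->
    Z x -> Z y.

(** ** Rational functions and Cartier divisors *)

(* The function field k(M), the i-th variable being chi^(e_i). *)
Definition ratfun (k : fieldType) (n : nat) := {fraction {mpoly k[n]}}.

Definition ratcst (k : fieldType) (n : nat) (c : k) : ratfun k n :=
  tofrac (mpolyC n c).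

Definition ratvar (k : fieldType) (n : nat) (i : 'I_n) : ratfun k n :=
  tofrac ('X_i : {mpoly k[n]}).

Definition ratfun_of (k : fieldType) (n : nat) (a : laurent k n) :
    ratfun k n :=
  \sum_(t <- a) ratcst n t.1 * \prod_i ratvar k i ^ t.2 0 i.

Definition regular_on (k : fieldType) (n : nat) (X : fan n) (s : {set ray X})
    (f : ratfun k n) : Prop :=
  exists2 a : laurent k n, regular s a & f = ratfun_of a.

Definition local_ring (k : fieldType) (n : nat) (X : fan n) (x : tpoint k X)
    (f : ratfun k n) : Prop :=
  exists a b : laurent k n,
    [/\ regular (cone_of x) a, regular (cone_of x) b, eval b x != 0 &
        f = ratfun_of a / ratfun_of b].

(* The ideal of Z in the local ring at x. *)
Definition local_ideal (k : fieldType) (n : nat) (X : fan n) (x : tpoint k X)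
    (Z : set (tpoint k X)) (f : ratfun k n) : Prop :=
  exists a b : laurent k n,
    [/\ regular (cone_of x) a, regular (cone_of x) b, eval b x != 0,
        f = ratfun_of a / ratfun_of b &
        forall y, Z y -> chart (cone_of x) y -> eval a y = 0].

(* Cartier divisors, given by local equations on the affine toric charts. On a
   smooth toric variety every Cartier divisor has this form, since line bundles
   on the charts are trivial. *)
Record cartier (k : fieldType) (n : nat) (X : fan n) := Cartier {
  equation : {set ray X} -> ratfun k n;
  equation_neq0 : forall s, s \in cones X -> equation s != 0;
  equation_compat : forall s t, s \in cones X -> t \in cones X ->
    regular_on (s :&: t) (equation s / equation t) }.

Definition effective (k : fieldType) (n : nat) (X : fan n)
    (D : cartier k X) : Prop :=
  forall s, s \in cones X -> regular_on s (equation D s).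

Definition divisor_support (k : fieldType) (n : nat) (X : fan n)
    (D : cartier k X) : set (tpoint k X) :=
  [set x | ~ (local_ring x (equation D (cone_of x)) /\
              local_ring x (equation D (cone_of x))^-1)].

(** ** Intersection numbers of divisors and curves *)

(* d is the dimension over k of O_{C,x} / (f), where f is a local equation of
   D at x; equivalently of O_{X,x} / (I_C + (f)). *)
Definition local_multiplicity (k : fieldType) (n : nat) (X : fan n)
    (D : cartier k X) (C : set (tpoint k X)) (x : tpoint k X) (d : nat) :
    Prop :=
  exists2 g : 'I_d -> ratfun k n, (forall i, local_ring x (g i)) &
    forall h, local_ring x h ->
      exists! c : {ffun 'I_d -> k},
        exists a b, [/\ local_ring x a, local_ideal x C b &
          h = \sum_i ratcst n (c i) * g i + a * equation D (cone_of x) + b].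

(* The intersection pairing D . C of a complete variety, through its defining
   properties: it is additive in D, it vanishes on principal divisors, and it
   is the sum of the local multiplicities when D is effective and does not
   contain C. On a projective variety these properties determine it, since
   every divisor is linearly equivalent to a difference of two effective
   divisors that do not contain C. *)
Definition intersection_pairing (k : fieldType) (n : nat) (X : fan n)
    (dot : cartier k X -> curve k X -> int) : Prop :=
  [/\ forall (D E F : cartier k X) (C : curve k X),
        (forall s, s \in cones X ->
           equation F s = equation D s * equation E s) ->
        dot F C = dot D C + dot E C,
      forall (D : cartier k X) (f : ratfun k n) (C : curve k X),
        (forall s, s \in cones X -> equation D s = f) -> dot D C = 0 &
      forall (D : cartier k X) (C : curve k X),
        effective D -> ~ (C `<=` divisor_support D) ->
        forall (l : nat) (p : 'I_l -> tpoint k X) (mu : 'I_l -> nat),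
          injective p ->
          (forall x, (C `&` divisor_support D) x <-> exists i, x = p i) ->
          (forall i, local_multiplicity D C (p i) (mu i)) ->
          dot D C = (\sum_i mu i)%N%:Z].

(* 1-cycles with coefficients in A, as formal sums of curves; A = int gives
   the integral cycles and A = R the real ones. *)
Definition cycle1 (k : fieldType) (n : nat) (X : fan n) (A : nzRingType) :=
  seq (A * curve k X).

Definition cycle_dot (k : fieldType) (n : nat) (X : fan n)
    (dot : cartier k X -> curve k X -> int) (A : nzRingType)
    (D : cartier k X) (z : cycle1 k X A) : A :=
  \sum_(t <- z) t.1 * (dot D t.2)%:~R.

(* Equality of the classes in N_1(X)_Z for A = int and in N_1(X) for A = R. *)
Definition num_equiv (k : fieldType) (n : nat) (X : fan n)
    (dot : cartier k X -> curve k X -> int) (A : nzRingType)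
    (z z' : cycle1 k X A) : Prop :=
  forall D, cycle_dot dot D z = cycle_dot dot D z'.

Definition combination (k : fieldType) (n : nat) (X : fan n) (A : nzRingType)
    (r : nat) (a : 'I_r -> A) (L : 'I_r -> curve k X) : cycle1 k X A :=
  [seq (a i, L i) | i <- enum 'I_r].

Definition classes_form_basis (k : fieldType) (n : nat) (X : fan n)
    (dot : cartier k X -> curve k X -> int)
    (r : nat) (L : 'I_r -> curve k X) : Prop :=
  forall z : cycle1 k X int,
    exists! a : {ffun 'I_r -> int}, num_equiv dot z (combination a L).

Definition class_in_cone (R : realType) (k : fieldType) (n : nat) (X : fan n)
    (dot : cartier k X -> curve k X -> int)
    (r : nat) (L : 'I_r -> curve k X) (C : curve k X) : Prop :=
  exists2 a : 'I_r -> R, (forall i, 0 <= a i) &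
    num_equiv dot [:: (1, C)] (combination a L).

(** ** Toric morphisms *)

(* y is the image of x under the toric morphism induced by the lattice map
   whose transpose is phi. *)
Definition toric_map (k : fieldType) (n n' : nat) (X : fan n) (X' : fan n')
    (phi : 'rV[int]_n' -> 'rV[int]_n) (x : tpoint k X)
    (y : tpoint k X') : Prop :=
  forall m, dual_cone (cone_of y) m ->
    dual_cone (cone_of x) (phi m) /\ chi y m = chi x (phi m).

(* The toric divisor of a ray: the union of the orbits of the cones that
   contain it. *)
Definition toric_divisor (k : fieldType) (n : nat) (X : fan n) (rho : ray X) :
    set (tpoint k X) :=
  [set x | rho \in cone_of x].

(** * The toric limit

   All indices are shifted by one: 0, ..., r-1 instead of 1, ..., r. Below,
   b i j stands for beta_{ij}; the fan in dimension r only uses the values at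
   i < j < r, so that the same b describes the whole tower. The ray (i, true)
   is generated by e_i^+ and (i, false) by e_i^-. *)

Definition limit_gen (b : nat -> nat -> int) (r : nat) (rho : 'I_r * bool) :
    'rV[int]_r :=
  let eplus (i : 'I_r) : 'rV[int]_r := delta_mx 0 i in
  if rho.2 then eplus rho.1
  else - eplus rho.1 - \sum_(j < r | (rho.1 < j)%N) b rho.1 j *: eplus j.

Definition limit_fan (b : nat -> nat -> int) (r : nat) : fan r :=
  @Fan r ('I_r * bool)%type (limit_gen b (r := r))
    [set s : {set 'I_r * bool} |
      [forall i, ~~ (((i, true) \in s) && ((i, false) \in s))]].

(* The transpose of the projection of Z^(j+1) onto the first j coordinates. *)
Definition extend0 (j : nat) (m : 'rV[int]_j) : 'rV[int]_j.+1 :=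
  \row_i oapp (m 0) 0 (unlift ord_max i).

Definition fibration (k : fieldType) (b : nat -> nat -> int) (j : nat)
    (x : tpoint k (limit_fan b j.+1)) (y : tpoint k (limit_fan b j)) : Prop :=
  toric_map (@extend0 j) x y.

(* The image of Z under the section of the fibration whose image is the toric
   divisor of the ray (j, sgn): the Schubert section for sgn = true, the
   non-Schubert section for sgn = false. *)
Definition section_image (k : fieldType) (b : nat -> nat -> int) (j : nat)
    (sgn : bool) (Z : set (tpoint k (limit_fan b j))) :
    set (tpoint k (limit_fan b j.+1)) :=
  [set x | exists2 y, Z y &
    toric_divisor ((ord_max, sgn) : ray (limit_fan b j.+1)) x /\
    fibration x y].

Definition schubert_point (k : fieldType) (b : nat -> nat -> int) (j : nat) :
    set (tpoint k (limit_fan b j)) :=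
  [set x : tpoint k (limit_fan b j) |
    cone_of x = [set rho : 'I_j * bool | rho.2]%SET].

(* The Schubert line in dimension j+1. *)
Definition schubert_line (k : fieldType) (b : nat -> nat -> int) (j : nat) :
    set (tpoint k (limit_fan b j.+1)) :=
  [set x | exists2 y, schubert_point y & fibration x y].

(* The curve L_I in dimension r, for a nonempty increasing sequence I of
   indices < r. Before the dimension reaches the first index of I, the
   recursion carries the empty set. *)
Fixpoint curve_of (k : fieldType) (b : nat -> nat -> int) (I : seq nat)
    (r : nat) : set (tpoint k (limit_fan b r)) :=
  match r with
  | 0 => set0
  | j.+1 => if j == head 0%N I then @schubert_line k b j
            else section_image (j \notin I) (@curve_of k b I j)
  end.

(** ** The index sequence of i *)

(* The least index l with j < l < r that satisfies p. *)
Definition next_index (r : nat) (p : pred nat) (j : nat) : option nat :=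
  ohead [seq l <- iota j.+1 (r - j.+1)%N | p l].

(* The indices j_k, k > 2, from the last index j and its row a. Indices
   increase strictly, so that fuel = r never runs out. *)
Fixpoint index_tail (fuel : nat) (r : nat) (b : nat -> nat -> int) (j : nat)
    (a : nat -> int) : seq nat :=
  match fuel with
  | 0 => [::]
  | fuel'.+1 =>
      if next_index r (fun l => a l < 0) j is Some j' then
        j' :: index_tail fuel' r b j' (fun l => - a j' * b j' l + a l)
      else [::]
  end.

Definition index_seq (r : nat) (b : nat -> nat -> int) (i : nat) : seq nat :=
  i :: if next_index r (fun l => 0 < b i l) i is Some j2 then
         j2 :: index_tail r r b j2 (fun l => b i j2 * b j2 l - b i l)
       else [::].

(** * Root data *)

(* A i j is the value of the simple root alpha_j on the coroot of alpha_i. *)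
Definition generalized_cartan (n : nat) (A : 'M[int]_n) : Prop :=
  [/\ forall i, A i i = 2,
      forall i j, i != j -> A i j <= 0 &
      forall i j, A i j = 0 -> A j i = 0].

(* beta_{ij} for the word w in the simple roots (0 out of range). *)
Definition word_coef (n : nat) (A : 'M[int]_n) (w : seq 'I_n) (i j : nat) :
    int :=
  if (onth w i, onth w j) is (Some s, Some t) then A s t else 0.

Definition toric_limit (n : nat) (A : 'M[int]_n) (w : seq 'I_n) :
    fan (size w) :=
  limit_fan (word_coef A w) (size w).

(* Main.v *)
(* The classes of the toric divisors D_j^- of the rays e_j^- form a basis of the
   Picard group, since the units of the torus are the monomials; so a curve class
   is determined by the numbers x_(j,-) = D_j^- . C, and the characters of the
   torus give x_(j,+) = x_(j,-) + sum_(l<j) beta_lj x_(l,-). A torus-invariant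
   curve is the orbit closure of a wall: all indices j <> i carry one ray of sign
   eps_j, and x_(i,+) = x_(i,-) = 1, x_(j,-eps_j) = 0. The index sequence of i is
   the choice of signs for which the remaining coefficients x_(j,eps_j), j > i,
   are nonpositive: L_(I_i) realizes the primitive relation of {e_i^+, e_i^-}.
   The matrix of the D_j^- . L_(I_i) is thus unitriangular, with nonpositive
   entries off the diagonal, and likewise for D_j^+. For an arbitrary wall curve
   C = sum_i y_i L_(I_i), solving the triangular system gives
   y_j >= max (x_(j,+), x_(j,-)) >= 0 by induction on j. *)
Require Import Defs.
From mathcomp Require Import all_boot all_order all_algebra.
From mathcomp Require Import fraction boolp classical_sets reals complex mpoly.
From mathcomp Require Import zify.

Set Implicit Arguments.
Unset Strict Implicit.
Unset Printing Implicit Defensive.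

Import Order.TTheory GRing.Theory Num.Theory.

Local Open Scope classical_set_scope.
Local Open Scope ring_scope.

(** * Laurent polynomials *)

Section Laurent.
Variables (k : fieldType) (n : nat).
Implicit Types (a b : laurent k n) (m : 'rV[int]_n) (c : k).

(** The pairing [dot] is known only through its axioms, and the only one that produces nonzero
    numbers concerns an effective divisor that does not contain the curve. A divisor [D_rho] with
    [rho] in the wall contains the curve, so its number is never computed locally. Two local cases
    suffice: a divisor disjoint from the curve, and one that crosses it transversally at a fixed
    point. Numerical equivalence quantifies over all Cartier divisors, so each of them has to be
    compared with a toric one through its local equations. Curves are abstract irreducible closed
    sets of Krull dimension 1. The correspondence between walls and invariant curves is therefore
    proved in the Zariski topology: on the open orbit of a wall curve, closed subsets are cut out by
    polynomials in one coordinate, and an infinite ground field separates the whole curve from its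
    finite subsets. *)

Definition ratmon m : ratfun k n := \prod_i ratvar k i ^ m 0 i.

Lemma ratvar_neq0 (i : 'I_n) : ratvar k i != 0.
Proof.
rewrite /ratvar tofrac_eq0; apply/eqP => /(congr1 (mcoeff U_(i))).
by rewrite mcoeffXU eqxx mcoeff0 => /eqP; rewrite oner_eq0.
Qed.

Lemma ratmonD m m' : ratmon (m + m') = ratmon m * ratmon m'.
Proof.
rewrite /ratmon -big_split /=; apply: eq_bigr => i _.
by rewrite mxE expfzDr // ratvar_neq0.
Qed.

Lemma ratmon0 : ratmon 0 = 1.
Proof. by rewrite /ratmon big1 // => i _; rewrite mxE. Qed.

Lemma ratmon_neq0 m : ratmon m != 0.
Proof. by apply/prodf_neq0 => i _; rewrite expfz_neq0 // ratvar_neq0. Qed.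

Lemma ratmonN m : ratmon (- m) = (ratmon m)^-1.
Proof.
apply: (mulfI (ratmon_neq0 m)).
by rewrite -ratmonD subrr ratmon0 divff // ratmon_neq0.
Qed.

Lemma ratmonB m m' : ratmon (m - m') = ratmon m / ratmon m'.
Proof. by rewrite ratmonD ratmonN. Qed.

Lemma ratcst0 : ratcst n (0 : k) = 0.
Proof. by rewrite /ratcst mpolyC0 tofrac0. Qed.

Lemma ratcst1 : ratcst n (1 : k) = 1.
Proof. by rewrite /ratcst mpolyC1 tofrac1. Qed.

Lemma ratcstD c c' : ratcst n (c + c') = ratcst n c + ratcst n c'.
Proof. by rewrite /ratcst mpolyCD tofracD. Qed.

Lemma ratcstM c c' : ratcst n (c * c') = ratcst n c * ratcst n c'.
Proof. by rewrite /ratcst mpolyCM tofracM. Qed.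

Lemma ratcst_eq0 c : (ratcst n c == 0) = (c == 0).
Proof. by rewrite /ratcst tofrac_eq0 mpolyC_eq0. Qed.

Lemma ratcstN c : ratcst n (- c) = - ratcst n c.
Proof. by rewrite /ratcst mpolyCN tofracN. Qed.

Definition lmul a b : laurent k n :=
  [seq (t.1 * t'.1, t.2 + t'.2) | t <- a, t' <- b].

Definition lscale c a : laurent k n := [seq (c * t.1, t.2) | t <- a].

Lemma ratfun_of_cons t a :
  ratfun_of (t :: a) = ratcst n t.1 * ratmon t.2 + ratfun_of a.
Proof. by rewrite /ratfun_of big_cons. Qed.

Lemma ratfun_of1 c m : ratfun_of [:: (c, m)] = ratcst n c * ratmon m.
Proof. by rewrite ratfun_of_cons /ratfun_of big_nil addr0. Qed.

Lemma ratfun_of_cat a b : ratfun_of (a ++ b) = ratfun_of a + ratfun_of b.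
Proof. by rewrite /ratfun_of big_cat. Qed.

Lemma ratfun_of_mul a b : ratfun_of (lmul a b) = ratfun_of a * ratfun_of b.
Proof.
rewrite /ratfun_of big_allpairs_dep mulr_suml /=; apply: eq_bigr => t _.
rewrite mulr_sumr; apply: eq_bigr => t' _ /=.
by rewrite ratcstM -/(ratmon _) ratmonD mulrACA.
Qed.

Lemma ratfun_of_scale c a : ratfun_of (lscale c a) = ratcst n c * ratfun_of a.
Proof.
rewrite /ratfun_of big_map mulr_sumr; apply: eq_bigr => t _ /=.
by rewrite ratcstM mulrA.
Qed.

(* Multiplying by a monomial turns a Laurent polynomial into a polynomial. *)
Definition lshift (N : nat) m : 'X_{1..n} :=
  [multinom absz (m 0 i + N%:Z)%R | i < n].

Definition lpoly (N : nat) a : {mpoly k[n]} :=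
  \sum_(t <- a) t.1 *: 'X_[lshift N t.2].

(** Under this bound the [absz] in [lshift] acts on nonnegative numbers, so shifting the exponents
    loses nothing. *)
Definition lbounded (N : nat) a : bool :=
  all (fun t : k * 'rV[int]_n => [forall i, 0 <= t.2 0 i + N%:Z]) a.

Lemma lbounded_exists a : exists N, lbounded N a.
Proof.
elim: a => [|t a [N hN]]; first by exists 0%N.
exists (N + \sum_i `|t.2 0%R i|)%N; apply/andP; split.
  apply/forallP => i; have : (`|t.2 0%R i| <= \sum_j `|t.2 0%R j|)%N.
    by rewrite (bigD1 i) //= leq_addr.
  lia.
apply/allP => u /(allP hN) /forallP h; apply/forallP => i; have := h i; lia.
Qed.

Lemma tofracX (m : 'X_{1..n}) :
  tofrac ('X_[m] : {mpoly k[n]}) = \prod_i ratvar k i ^+ m i.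
Proof.
by rewrite mpolyXE_id rmorph_prod; apply: eq_bigr => i _; rewrite rmorphXn.
Qed.

Lemma tofrac_lpoly N a : lbounded N a ->
  tofrac (lpoly N a) = ratmon (const_mx N%:Z) * ratfun_of a.
Proof.
move=> hN; rewrite /lpoly /ratfun_of rmorph_sum mulr_sumr.
rewrite big_seq [RHS]big_seq; apply: eq_bigr => t /(allP hN) /forallP h.
rewrite -mul_mpolyC rmorphM /= mulrCA; congr (_ * _).
rewrite tofracX -/(ratmon _) -ratmonD; apply: eq_bigr => i _.
rewrite mnmE !mxE addrC; have := h i.
by case: (_ + _).
Qed.

(** Linear independence of monomials. A formal sum may repeat an exponent, so the vanishing of
    coefficients is tested against an arbitrary function of the exponent: [chi x] gives evaluations,
    indicator functions give coefficients. *)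
Lemma ratfun_of_eq0 a : ratfun_of a = 0 ->
  forall g : 'rV[int]_n -> k, \sum_(t <- a) t.1 * g t.2 = 0.
Proof.
move=> a0 g; have [N hN] := lbounded_exists a.
have P0 : lpoly N a = 0.
  by apply/eqP; rewrite -tofrac_eq0 tofrac_lpoly // a0 mulr0.
pose g' (mu : 'X_{1..n}) := g (\row_i ((mu i)%:Z - N%:Z)).
pose s := undup [seq lshift N t.2 | t <- a].
(* Terms are grouped by exponent; each group adds up to a coefficient of [lpoly N a], which is
   zero. *)
have -> : \sum_(t <- a) t.1 * g t.2 =
    \sum_(t <- a) \sum_(mu <- s) (t.1 * (lshift N t.2 == mu)%:R) * g' mu.
  rewrite big_seq [RHS]big_seq; apply: eq_bigr => t ta.
  rewrite (bigD1_seq (lshift N t.2)) /= ?undup_uniq //; last first.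
    by rewrite mem_undup; apply/mapP; exists t.
  rewrite eqxx mulr1 big1 ?addr0 => [|mu /negPf h]; last first.
    by rewrite eq_sym h mulr0 mul0r.
  congr (_ * g _); apply/rowP => i; rewrite mxE mnmE.
  have /forallP/(_ i) := allP hN t ta; lia.
rewrite exchange_big big1_seq //= => mu _.
rewrite -mulr_suml -[X in X * _]/(_).
have -> : \sum_(t <- a) t.1 * (lshift N t.2 == mu)%:R = (lpoly N a)@_mu.
  rewrite /lpoly raddf_sum; apply: eq_bigr => t _ /=.
  by rewrite mcoeffZ mcoeffX.
by rewrite P0 mcoeff0 mul0r.
Qed.

Lemma ratfun_of_inj a b : ratfun_of a = ratfun_of b ->
  forall g : 'rV[int]_n -> k,
    \sum_(t <- a) t.1 * g t.2 = \sum_(t <- b) t.1 * g t.2.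
Proof.
move=> ab g.
have := @ratfun_of_eq0 (a ++ lscale (-1) b) _ g.
rewrite ratfun_of_cat ratfun_of_scale ab ratcstN ratcst1 mulN1r subrr.
move=> /(_ erefl); rewrite big_cat big_map /=.
under [X in _ + X]eq_bigr do rewrite mulN1r mulNr.
by rewrite sumrN => /subr0_eq.
Qed.

(* Comparing the smallest and the largest monomials of the factors. *)
Lemma mpoly_dvd_monomial (P Q : {mpoly k[n]}) (mu : 'X_{1..n}) :
  P * Q = 'X_[mu] -> exists c nu, P = c *: 'X_[nu].
Proof.
move=> PQ; have X0 : ('X_[mu] : {mpoly k[n]}) != 0.
  by apply/eqP => /(congr1 (mcoeff mu)) /eqP;
     rewrite mcoeffX eqxx mcoeff0 oner_eq0.
have P0 : P != 0 by apply: contraNneq X0 => P0; rewrite -PQ P0 mul0r.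
have Q0 : Q != 0 by apply: contraNneq X0 => Q0; rewrite -PQ Q0 mulr0.
have low (p : {mpoly k[n]}) : p != 0 ->
    exists2 m : 'X_{1..n}, m \in msupp p &
      forall m' : 'X_{1..n}, m' \in msupp p -> (m <= m')%O.
  move=> p0.
  have: msupp p != [::] by apply: contraNneq p0 => /eqP; rewrite msupp_eq0.
  elim: (msupp p) => // m [_ _|m' s IH _].
    by exists m; rewrite ?mem_head // => m'; rewrite inE => /eqP ->.
  have [//|m0 m0s h] := IH.
  have [le|lt] := leP m m0.
    exists m; rewrite ?mem_head // => m1; rewrite inE => /orP[/eqP->//|/h].
    exact: le_trans.
  exists m0; first by rewrite in_cons m0s orbT.
  by move=> m1; rewrite in_cons => /orP[/eqP->|/h//]; apply: ltW.
have [p0 p0P p0m] := low _ P0; have [q0 q0Q q0m] := low _ Q0.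
(* Only the pair of minima adds up to [p0 + q0], so this coefficient is nonzero and [mu = p0 + q0].
   The leading monomials have the same sum, which forces [p0 = mlead P]. *)
have : (P * Q)@_(p0 + q0) = P@_p0 * Q@_q0.
  rewrite mpolyME raddf_sum /= (bigD1_seq (p0, q0)) /=; last 2 first.
  - by apply/allpairsP; exists (p0, q0).
  - by rewrite allpairs_uniq ?msupp_uniq // => -[? ?] [? ?].
  rewrite mcoeffZ mcoeffX eqxx mulr1 big1_seq ?addr0 // => -[m1 m2] /=.
  case/andP => ne /allpairsP[[m1' m2'] /= [m1P m2Q [? ?]]]; subst m1' m2'.
  rewrite mcoeffZ mcoeffX; case: eqP => [e|_]; last by rewrite mulr0.
  case/negP: ne; rewrite xpair_eqE.
  have := p0m _ m1P; rewrite le_eqVlt => /orP[/eqP p01|lt].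
    by move: e; rewrite -p01 => /addmI ->; rewrite !eqxx.
  by have := ltmc_le_add lt (q0m _ m2Q); rewrite e ltxx.
rewrite PQ mcoeffX; case: eqP => [e _|_ /esym/eqP]; last first.
  by rewrite mulf_eq0 !mcoeff_eq0 p0P q0Q.
have lead : (mlead P + mlead Q)%MM = (p0 + q0)%MM.
  by rewrite -mleadM // PQ mleadXm.
have pP : p0 = mlead P.
  have := msupp_le_mlead p0P; rewrite le_eqVlt => /orP[/eqP //|lt].
  by have := ltmc_le_add lt (msupp_le_mlead q0Q); rewrite lead ltxx.
exists P@_p0, p0; apply/mpolyP => m; rewrite mcoeffZ mcoeffX.
case: eqP => [<-|/eqP]; first by rewrite mulr1.
rewrite mulr0 => ne; apply: memN_msupp_eq0; apply: contra ne => mP.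
by rewrite eq_le p0m // pP msupp_le_mlead.
Qed.

(** Shifting the exponents turns both factors into polynomials whose product is a monomial, and a
    factor of a monomial is a single term. *)
Lemma laurent_unit a b : ratfun_of a * ratfun_of b = 1 ->
  exists c m, c != 0 /\ ratfun_of a = ratcst n c * ratmon m.
Proof.
move=> ab1; have [N hN] := lbounded_exists a.
have [N' hN'] := lbounded_exists b.
have : lpoly N a * lpoly N' b = 'X_[[multinom (N + N')%N | i < n]].
  apply/eqP; rewrite -tofrac_eq tofracM !tofrac_lpoly // mulrACA ab1 mulr1.
  rewrite -ratmonD tofracX; apply/eqP; apply: eq_bigr => i _.
  by rewrite !mxE mnmE -PoszD.
case/mpoly_dvd_monomial => c [nu Pa].
have aE : ratfun_of a = ratcst n c * ratmon (\row_i (nu i)%:Z - const_mx N%:Z).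
  apply: (mulfI (ratmon_neq0 (const_mx N%:Z))); rewrite -tofrac_lpoly // Pa.
  rewrite mulrCA -ratmonD addrC subrK -mul_mpolyC tofracM tofracX.
  by congr (_ * _); apply: eq_bigr => i _; rewrite mxE.
exists c, (\row_i (nu i)%:Z - const_mx N%:Z); split => //.
apply: contra_eq_neq ab1 => c0.
by rewrite aE c0 ratcst0 !mul0r eq_sym oner_eq0.
Qed.

End Laurent.

(** * Points of a toric variety *)

Section Pairing.
Variable n : nat.
Implicit Types (m u : 'rV[int]_n) (X : fan n).

Lemma lpairingDl m m' u : lpairing (m + m') u = lpairing m u + lpairing m' u.
Proof.
by rewrite /lpairing -big_split; apply: eq_bigr => i _; rewrite mxE mulrDl.
Qed.

Lemma lpairingNl m u : lpairing (- m) u = - lpairing m u.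
Proof.
by rewrite /lpairing -sumrN; apply: eq_bigr => i _; rewrite mxE mulNr.
Qed.

Lemma lpairing0l u : lpairing 0 u = 0.
Proof. by rewrite /lpairing big1 // => i _; rewrite mxE mul0r. Qed.

Lemma orthogonal_dual X (s : {set ray X}) m :
  orthogonal_cone s m -> dual_cone s m.
Proof.
move=> /forall_inP h; apply/forall_inP => rho /h /eqP ->; exact: lexx.
Qed.

Lemma orthogonal0 X (s : {set ray X}) : orthogonal_cone s 0.
Proof. by apply/forall_inP => rho _; rewrite lpairing0l. Qed.

Lemma orthogonalD X (s : {set ray X}) m m' :
  orthogonal_cone s m -> orthogonal_cone s m' -> orthogonal_cone s (m + m').
Proof.
move=> /forall_inP h /forall_inP h'; apply/forall_inP => rho rs.
by rewrite lpairingDl (eqP (h _ rs)) (eqP (h' _ rs)).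
Qed.

Lemma orthogonalN X (s : {set ray X}) m :
  orthogonal_cone s m -> orthogonal_cone s (- m).
Proof.
move=> /forall_inP h; apply/forall_inP => rho rs.
by rewrite lpairingNl (eqP (h _ rs)).
Qed.

Lemma orthogonal_subset X (s t : {set ray X}) m :
  s \subset t -> orthogonal_cone t m -> orthogonal_cone s m.
Proof.
by move=> /fintype.subsetP st /forall_inP h; apply/forall_inP => rho /st /h.
Qed.

Lemma dual_subset X (s t : {set ray X}) m :
  s \subset t -> dual_cone t m -> dual_cone s m.
Proof.
by move=> /fintype.subsetP st /forall_inP h; apply/forall_inP => rho /st /h.
Qed.

Lemma dualD X (s : {set ray X}) m m' :
  dual_cone s m -> dual_cone s m' -> dual_cone s (m + m').
Proof.
move=> /forall_inP h /forall_inP h'; apply/forall_inP => rho rs.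
by rewrite lpairingDl addr_ge0 ?h ?h'.
Qed.

(** The annihilator is a face of the dual cone; this extends the multiplicativity of [chi] from the
    orthogonal lattice to the whole semigroup of a chart. *)
Lemma orthogonal_face X (s : {set ray X}) m m' :
  dual_cone s m -> dual_cone s m' ->
  orthogonal_cone s (m + m') = orthogonal_cone s m && orthogonal_cone s m'.
Proof.
move=> /forall_inP h /forall_inP h'; apply/idP/andP => [/forall_inP o|[]].
  split; apply/forall_inP => rho rs; move: (o _ rs);
    by rewrite lpairingDl paddr_eq0 ?h ?h' // => /andP[].
exact: orthogonalD.
Qed.

End Pairing.

Lemma divf_cross (F : fieldType) (x y z w : F) : y != 0 -> w != 0 ->
  x / y = z / w -> x * w = z * y.
Proof. by move=> y0 w0 e; apply/eqP; rewrite -eqr_div // e. Qed.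

Section Points.
Variables (k : fieldType) (n : nat) (X : fan n).
Implicit Types (a b : laurent k n) (m : 'rV[int]_n) (x y : tpoint k X).
Implicit Types (s t : {set ray X}) (f g : ratfun k n) (v : k).

Lemma tpoint_ext x y : cone_of x = cone_of y -> chi x =1 chi y -> x = y.
Proof.
case: x => s c sP cn c0 cD; case: y => s' c' sP' cn' c0' cD' /= es /funext ec.
subst s' c'; congr TPoint; exact: Prop_irrelevance.
Qed.

Lemma chi_eq0 x m : ~~ orthogonal_cone (cone_of x) m -> chi x m = 0.
Proof. by rewrite -chi_neq0 negbK => /eqP. Qed.

Lemma chi_dualD x m m' :
  dual_cone (cone_of x) m -> dual_cone (cone_of x) m' ->
  chi x (m + m') = chi x m * chi x m'.
Proof.
move=> h h'; case: (boolP (orthogonal_cone (cone_of x) (m + m'))) => o.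
  by move: o; rewrite orthogonal_face // => /andP[]; apply: chiD.
rewrite chi_eq0 //; move: o; rewrite orthogonal_face // negb_and.
by case/orP => /chi_eq0 ->; rewrite ?mul0r ?mulr0.
Qed.

Lemma eval_cat a b x : eval (a ++ b) x = eval a x + eval b x.
Proof. by rewrite /eval big_cat. Qed.

Lemma eval_scale v a x : eval (lscale v a) x = v * eval a x.
Proof.
by rewrite /eval big_map mulr_sumr; apply: eq_bigr => t _; rewrite mulrA.
Qed.

Lemma eval1 v m x : eval [:: (v, m)] x = v * chi x m.
Proof. by rewrite /eval big_seq1. Qed.

Lemma eval_mul a b x : regular (cone_of x) a -> regular (cone_of x) b ->
  eval (lmul a b) x = eval a x * eval b x.
Proof.
move=> /allP ra /allP rb; rewrite /eval big_allpairs_dep mulr_suml /=.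
rewrite big_seq [RHS]big_seq; apply: eq_bigr => t ta.
rewrite mulr_sumr big_seq [RHS]big_seq; apply: eq_bigr => t' tb /=.
by rewrite chi_dualD ?(ra _ ta) ?(rb _ tb) // mulrACA.
Qed.

Lemma eval_ratfun a b x : ratfun_of a = ratfun_of b -> eval a x = eval b x.
Proof. by move=> ab; apply: (ratfun_of_inj ab). Qed.

Lemma ratfun_of_neq0 a x : eval a x != 0 -> ratfun_of a != 0.
Proof.
apply: contra_neq => a0; rewrite (@eval_ratfun a [::] x) /eval ?big_nil //.
by rewrite a0 /ratfun_of big_nil.
Qed.

Lemma regular_cat s a b :
  regular s (a ++ b) = regular s a && regular s b.
Proof. exact: all_cat. Qed.

Lemma regular_scale s v a : regular s (lscale v a) = regular s a.
Proof. by rewrite /regular all_map. Qed.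

Lemma regular_mul s a b : regular s a -> regular s b -> regular s (lmul a b).
Proof.
move=> /allP ra /allP rb; apply/allP => _ /allpairsP[[t t'] /= [ta tb ->]] /=.
by apply: dualD; [apply: ra|apply: rb].
Qed.

Lemma regular1 s v m : regular s [:: (v, m)] = dual_cone s m.
Proof. by rewrite /regular /= andbT. Qed.

Lemma regular_subset s t a : s \subset t -> regular t a -> regular s a.
Proof.
move=> st /allP h; apply/allP => u /h; exact: dual_subset.
Qed.

(* f lies in the local ring at x and takes the value v there. *)
Definition residue x f v : Prop := exists a b,
  [/\ regular (cone_of x) a, regular (cone_of x) b, eval b x != 0,
      f = ratfun_of a / ratfun_of b & eval a x = v * eval b x].

Lemma local_ring_residue x f : local_ring x f -> exists v, residue x f v.
Proof.
move=> [a [b [ra rb b0 ->]]]; exists (eval a x / eval b x), a, b.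
by split; rewrite ?divfK.
Qed.

Lemma local_ideal_residue x (Z : set (tpoint k X)) f :
  Z x -> local_ideal x Z f -> residue x f 0.
Proof.
move=> Zx [a [b [ra rb b0 -> h]]]; exists a, b.
by split; rewrite ?mul0r // h // /chart /=.
Qed.

Lemma residue_inj x f v v' : residue x f v -> residue x f v' -> v = v'.
Proof.
move=> [a [b [ra rb b0 -> ea]]] [a' [b' [ra' rb' b0' e ea']]].
have : eval (lmul a b') x = eval (lmul a' b) x.
  apply: eval_ratfun; rewrite !ratfun_of_mul.
  exact: (divf_cross (ratfun_of_neq0 b0) (ratfun_of_neq0 b0') e).
by rewrite !eval_mul // ea ea' mulrAC => /(mulIf b0) /(mulIf b0').
Qed.

Lemma residueD x f g v w :
  residue x f v -> residue x g w -> residue x (f + g) (v + w).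
Proof.
move=> [a [b [ra rb b0 -> ea]]] [a' [b' [ra' rb' b0' -> ea']]].
exists (lmul a b' ++ lmul a' b), (lmul b b'); split.
- by rewrite regular_cat !regular_mul.
- by rewrite regular_mul.
- by rewrite eval_mul // mulf_neq0.
- rewrite ratfun_of_cat !ratfun_of_mul addf_div ?(@ratfun_of_neq0 _ x) //.
- rewrite eval_cat !eval_mul // ea ea' mulrDl; congr (_ + _).
    by rewrite mulrA.
  by rewrite -mulrA [_ * eval b x]mulrC.
Qed.

Lemma residueM x f g v w :
  residue x f v -> residue x g w -> residue x (f * g) (v * w).
Proof.
move=> [a [b [ra rb b0 -> ea]]] [a' [b' [ra' rb' b0' -> ea']]].
exists (lmul a a'), (lmul b b'); split; rewrite ?regular_mul ?eval_mul //.
- by rewrite mulf_neq0.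
- by rewrite !ratfun_of_mul mulf_div.
- by rewrite ea ea' mulrACA.
Qed.

Lemma residue_laurent x a :
  regular (cone_of x) a -> residue x (ratfun_of a) (eval a x).
Proof.
move=> ra; exists a, [:: (1, 0)].
rewrite regular1 eval1 chi0 ratfun_of1 ratcst1 ratmon0 !mulr1 divr1.
by rewrite oner_eq0 orthogonal_dual ?orthogonal0.
Qed.

Lemma residue_cst x v : residue x (ratcst n v) v.
Proof.
have := @residue_laurent x [:: (v, 0)]; rewrite regular1 ratfun_of1 eval1.
by rewrite ratmon0 chi0 !mulr1; apply; rewrite orthogonal_dual ?orthogonal0.
Qed.

Lemma residue_mon x m :
  dual_cone (cone_of x) m -> residue x (ratmon k m) (chi x m).
Proof.
have := @residue_laurent x [:: (1, m)]; rewrite regular1 ratfun_of1 eval1.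
by rewrite ratcst1 !mul1r.
Qed.

Lemma residue_local_ring x f v : residue x f v -> local_ring x f.
Proof. by move=> [a [b [? ? ? ? _]]]; exists a, b. Qed.

Lemma closed_set0 : zariski_closed (set0 : set (tpoint k X)).
Proof.
move=> s _; exists [set [:: (1, 0)]].
  move=> a ->; rewrite regular1. exact/orthogonal_dual/orthogonal0.
move=> x _; split => // /(_ _ erefl) /eqP.
by rewrite eval1 chi0 mulr1 oner_eq0.
Qed.

Lemma closedU (A B : set (tpoint k X)) :
  zariski_closed A -> zariski_closed B -> zariski_closed (A `|` B).
Proof.
move=> cA cB s sX; have [F rF hF] := cA s sX; have [G rG hG] := cB s sX.
exists [set c | exists a b, [/\ F a, G b & c = lmul a b]].
  by move=> _ [a [b [/rF ra /rG rb ->]]]; apply: regular_mul.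
move=> x xs; split.
  move=> AB _ [a [b [Fa Gb ->]]].
  rewrite eval_mul; [|exact: regular_subset (rF _ Fa)
                     |exact: regular_subset (rG _ Gb)].
  case: AB => [/(hF x xs) h|/(hG x xs) h].
    by rewrite h ?mul0r.
  by rewrite [eval b x]h ?mulr0.
move=> h; have [Ax|nAx] := pselect (A x); [by left|right].
apply/(hG x xs) => b Gb.
have /existsNP[a /not_implyP[Fa /eqP a0]] : ~ forall a, F a -> eval a x = 0.
  by move/(hF x xs).
have := h _ (ex_intro _ a (ex_intro _ b (And3 Fa Gb erefl))).
rewrite eval_mul; [|exact: regular_subset (rF _ Fa)
                   |exact: regular_subset (rG _ Gb)].
by move/eqP; rewrite mulf_eq0 (negPf a0) => /eqP.
Qed.

Lemma closed_bigU (I : eqType) (l : seq I) (A : I -> set (tpoint k X)) :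
  (forall i, i \in l -> zariski_closed (A i)) ->
  zariski_closed [set x | exists2 i, i \in l & A i x].
Proof.
elim: l => [|i l IH] h.
  rewrite (_ : [set x | _] = set0); first exact: closed_set0.
  by apply/seteqP; split => // x [].
rewrite (_ : [set x | _] = A i `|` [set x | exists2 i, i \in l & A i x]).
  apply: closedU; first by apply: h; rewrite mem_head.
  by apply: IH => j jl; apply: h; rewrite in_cons jl orbT.
apply/seteqP; split => x /=.
  by move=> [j]; rewrite in_cons => /orP[/eqP->|]; [left|right; exists j].
move=> [xi|[j jl xj]]; first by exists i; rewrite ?mem_head.
by exists j; rewrite // in_cons jl orbT.
Qed.

Lemma irreducible_bigU (I : eqType) (l : seq I) (A : I -> set (tpoint k X))
    (Z : set (tpoint k X)) :
  irreducible_closed Z -> (forall i, i \in l -> zariski_closed (A i)) ->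
  Z `<=` [set x | exists2 i, i \in l & A i x] ->
  exists2 i, i \in l & Z `<=` A i.
Proof.
move=> [cZ [z Zz] hZ]; elim: l => [|i l IH] h; first by move=> /(_ z Zz) [].
move=> sub.
have [|||ZA|/IH[|j jl Zj]] := hZ (A i) [set x | exists2 i, i \in l & A i x].
- by apply: h; rewrite mem_head.
- by apply: closed_bigU => j jl; apply: h; rewrite in_cons jl orbT.
- move=> x /sub [j]; rewrite in_cons.
  by move=> /orP[/eqP->|]; [left|right; exists j].
- by exists i; rewrite ?mem_head.
- by move=> j jl; apply: h; rewrite in_cons jl orbT.
- by exists j; rewrite // in_cons jl orbT.
Qed.

Lemma irreducible1 x : zariski_closed [set x] -> irreducible_closed [set x].
Proof.
move=> cx; split => //; first by exists x.
by move=> A B _ _ /(_ x erefl) [] h; [left|right] => y ->.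
Qed.

End Points.

(** * The cones of the limit fan *)

Section LimitFan.
Variables (b : nat -> nat -> int) (r : nat).
Local Notation X := (limit_fan b r).
Implicit Types (m v : 'rV[int]_r) (eps : 'I_r -> bool) (s t : {set ray X}).
Implicit Types (rho : ray X).

Definition gen (rho : 'I_r * bool) : 'rV[int]_r := limit_gen b rho.

Lemma gen_entry (i j : 'I_r) (e : bool) :
  gen (i, e) 0 j =
  if e then (i == j)%:R else - (i == j)%:R - (if (i < j)%N then b i j else 0).
Proof.
rewrite /gen /limit_gen /=; case: e; first by rewrite mxE eqxx eq_sym.
rewrite !mxE summxE eqxx /= [j == i]eq_sym; congr (_ - _).
case: ifPn => ij; last first.
  rewrite big1 // => l il; rewrite !mxE eqxx /=; case: eqP => [e|]; last first.
    by rewrite mulr0.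
  by rewrite e il in ij.
rewrite (bigD1 j) //= big1 ?addr0 => [|l /andP[_ lj]]; rewrite !mxE !eqxx /=.
  by rewrite mulr1.
by rewrite eq_sym (negPf lj) mulr0.
Qed.

Lemma lpairing_gen m (i : 'I_r) (e : bool) :
  lpairing m (gen (i, e)) =
  if e then m 0 i else - m 0 i - \sum_(j < r | (i < j)%N) b i j * m 0 j.
Proof.
rewrite /lpairing; under eq_bigr do rewrite gen_entry.
case: e.
  rewrite (bigD1 i) //= big1 ?addr0 ?eqxx ?mulr1 // => j ij.
  by rewrite eq_sym (negPf ij) mulr0.
under eq_bigr do rewrite mulrBr mulrN.
rewrite big_split /= sumrN; congr (_ + _).
  rewrite (bigD1 i) //= big1 ?addr0 ?eqxx ?mulr1 // => j ij.
  by rewrite eq_sym (negPf ij) mulr0.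
rewrite sumrN big_mkcond [in RHS]big_mkcond /=; congr (- _).
by apply: eq_bigr => j _; case: ifP => _; rewrite ?mulr0 // mulrC.
Qed.

Definition gen_mx eps : 'M[int]_r := \matrix_(i, j) gen (i, eps i) 0 j.

(** The rays with signs [eps] form a lattice basis, since [e_i^-] is [- e_i^+] plus a combination of
    later basis vectors: every maximal cone is smooth. *)
Lemma gen_mx_unit eps : (gen_mx eps)^T \in unitmx.
Proof.
rewrite unitmxE det_trig.
  apply: rpred_prod => i _; rewrite !mxE gen_entry eqxx ltnn.
  by case: (eps i); rewrite ?subr0 ?unitrN unitr1.
apply/is_trig_mxP => i j ij; rewrite !mxE gen_entry.
have ne : (j == i) = false by apply/negbTE; rewrite neq_ltn ij orbT.
by rewrite ne ltnNge (ltnW ij) oppr0 subr0 if_same.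
Qed.

(** The character with values [v] on the rays of signs [eps]; [sol eps (delta_mx 0 i)] is a dual
    basis vector. *)
Definition sol eps v : 'rV[int]_r := v *m invmx (gen_mx eps)^T.

Lemma pairing_mx eps m (i : 'I_r) :
  lpairing m (gen (i, eps i)) = (m *m (gen_mx eps)^T) 0 i.
Proof. by rewrite mxE; apply: eq_bigr => j _; rewrite !mxE. Qed.

Lemma sol_pairing eps v (i : 'I_r) :
  lpairing (sol eps v) (gen (i, eps i)) = v 0 i.
Proof. by rewrite pairing_mx mulmxKV // gen_mx_unit. Qed.

Lemma solD eps v v' : sol eps (v + v') = sol eps v + sol eps v'.
Proof. exact: mulmxDl. Qed.

Lemma sol_unique eps m v :
  (forall i, lpairing m (gen (i, eps i)) = v 0 i) -> sol eps v = m.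
Proof.
move=> h; rewrite -(mulmxK (gen_mx_unit eps) m); congr (_ *m _).
by apply/rowP => i; rewrite -pairing_mx h.
Qed.

(** Descending induction on the coordinate: a ray of index [j] involves only coordinates from [j]
    on. *)
Lemma pairing_triangular eps m (i : 'I_r) :
  (forall j : 'I_r, (i < j)%N -> lpairing m (gen (j, eps j)) = 0) ->
  forall j : 'I_r, (i < j)%N -> m 0 j = 0.
Proof.
move=> h j; have [d] := ubnP (r - j)%N; elim: d j => // d IH j jd ij.
have := h j ij; rewrite lpairing_gen big1 => [|l jl]; last first.
  rewrite IH ?mulr0 //; last exact: ltn_trans jl.
  have := ltn_ord l; lia.
by case: (eps j) => //; rewrite subr0 => /eqP; rewrite oppr_eq0 => /eqP.
Qed.

(** The dual vector has no coordinates beyond [i], so the two rays of index [i] see only its [i]-th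
    coordinate, with opposite signs. *)
Lemma pairing_opposite eps (i : 'I_r) (e : bool) :
  e != eps i -> lpairing (sol eps (delta_mx 0 i)) (gen (i, e)) = -1.
Proof.
move=> ne; set m := sol _ _.
have m0 : forall j : 'I_r, (i < j)%N -> m 0 j = 0.
  apply: (@pairing_triangular eps) => j ij.
  by rewrite sol_pairing mxE eqxx /= -val_eqE /= (gtn_eqF ij).
have := sol_pairing eps (delta_mx 0 i) i; rewrite -/m !lpairing_gen.
have -> : \sum_(j < r | (i < j)%N) b i j * m 0 j = 0.
  by rewrite big1 // => j /m0 ->; rewrite mulr0.
by rewrite [delta_mx _ _ _ _]mxE !eqxx /= subr0; case: e (eps i) ne => [] [] //= _; lia.
Qed.

(** An index without a ray in [s] receives [true]; thus [sgn s] completes a cone to a maximal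
    one. *)
Definition sgn s (i : 'I_r) : bool := (i, false) \notin s.

Lemma cone_sgn s rho : s \in cones X -> rho \in s -> rho.2 = sgn s rho.1.
Proof.
rewrite inE => /forallP h; case: rho => i [] si; rewrite /sgn /= ?si //.
by have := h i; rewrite [X in X && _]si => /= ->.
Qed.

Lemma cone_sgnP s :
  reflect (exists eps, forall rho, rho \in s -> rho.2 = eps rho.1)
    (s \in cones X).
Proof.
apply: (iffP idP) => [sX|[eps h]].
  by exists (sgn s) => rho; apply: cone_sgn.
rewrite inE; apply/forallP => i; apply/negP => /andP[/h /= e /h /= e'].
by rewrite -e in e'.
Qed.

Lemma cone_subset s t : s \subset t -> t \in cones X -> s \in cones X.
Proof.
move=> /fintype.subsetP st /cone_sgnP [eps h]; apply/cone_sgnP.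
by exists eps => rho /st /h.
Qed.

(** Exponent of a local equation, on the chart of [s], of the toric divisor with coefficients [v].
    The values used outside [s] only change it by a unit. *)
Definition csol s (v : {ffun ray X -> int}) : 'rV[int]_r :=
  sol (sgn s) (\row_i v (i, sgn s i)).

Lemma csolD s (v v' : {ffun ray X -> int}) :
  csol s (v + v') = csol s v + csol s v'.
Proof.
by rewrite /csol -solD; congr sol; apply/rowP => i; rewrite !mxE ffunE.
Qed.

Lemma csol_pairing s (v : {ffun ray X -> int}) rho :
  s \in cones X -> rho \in s -> lpairing (csol s v) (gen rho) = v rho.
Proof.
move=> sX rs; have := cone_sgn sX rs; case: rho rs => i e rs /= ->.
by rewrite sol_pairing mxE.
Qed.

Definition ray_delta rho : {ffun ray X -> int} := [ffun rho' => (rho' == rho)%:R].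

Definition dvec s rho := csol s (ray_delta rho).

Lemma dvec_pairing s rho rho' : s \in cones X -> rho' \in s ->
  lpairing (dvec s rho) (gen rho') = (rho' == rho)%:R.
Proof. by move=> sX rs; rewrite csol_pairing // ffunE. Qed.

Lemma dvec_dual s rho : s \in cones X -> dual_cone s (dvec s rho).
Proof.
by move=> sX; apply/forall_inP => rho' rs; rewrite [lpairing _ _]dvec_pairing.
Qed.

Lemma dvec_orthogonal s t rho : t \in cones X -> s \subset t ->
  orthogonal_cone s (dvec t rho) = (rho \notin s).
Proof.
move=> tX /fintype.subsetP st; apply/forall_inP/idP => [h|rs rho' rs'].
  apply/negP => rs; have := h _ rs.
  by rewrite [lpairing _ _]dvec_pairing ?st // eqxx.
rewrite [lpairing _ _]dvec_pairing ?st //.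
by have [e|//] := eqVneq rho' rho; rewrite -e rs' in rs.
Qed.

(** Biduality of cones: a ray outside [s] is separated from [s] by a dual basis vector, taken with a
    minus sign if the ray has the sign given by [sgn s]. *)
Lemma dual_cone_le s t : s \in cones X -> t \in cones X ->
  (forall m, dual_cone s m -> dual_cone t m) -> t \subset s.
Proof.
move=> sX tX h; apply/fintype.subsetP => rho rt; apply: contraT => rs.
have pos m : dual_cone s m -> 0 <= lpairing m (gen rho).
  by move=> /h /forall_inP; apply.
have [e|ne] := eqVneq rho.2 (sgn s rho.1).
  have : dual_cone s (- sol (sgn s) (delta_mx 0 rho.1)).
    apply/forall_inP => rho' rs'; rewrite lpairingNl.
    have := cone_sgn sX rs'; case: rho' rs' => i e' rs' /= ->.
    rewrite [lpairing _ _]sol_pairing mxE eqxx /=.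
    case: eqP => // ei; case/negP: rs.
    rewrite (surjective_pairing rho) e -ei.
    by have /= <- := cone_sgn sX rs'.
  move=> /pos; rewrite lpairingNl (surjective_pairing rho) e.
  by rewrite sol_pairing mxE !eqxx.
have : dual_cone s (sol (sgn s) (delta_mx 0 rho.1)).
  apply/forall_inP => rho' rs'.
  have := cone_sgn sX rs'; case: rho' rs' => i e' rs' /= ->.
  by rewrite [lpairing _ _]sol_pairing mxE.
by move=> /pos; rewrite (surjective_pairing rho) pairing_opposite.
Qed.

Definition max_cone eps : {set ray X} := [set rho : ray X | rho.2 == eps rho.1].

Definition wall eps (i : 'I_r) : {set ray X} :=
  [set rho : ray X | (rho.2 == eps rho.1) && (rho.1 != i)].

Lemma max_coneX eps : max_cone eps \in cones X.
Proof. by apply/cone_sgnP; exists eps => rho; rewrite inE => /eqP. Qed.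

Lemma wall_sub eps i : wall eps i \subset max_cone eps.
Proof. by apply/fintype.subsetP => rho; rewrite !inE => /andP[]. Qed.

Lemma wallX eps i : wall eps i \in cones X.
Proof. exact: cone_subset (wall_sub eps i) (max_coneX eps). Qed.

Lemma max_cone_orthogonal eps m : orthogonal_cone (max_cone eps) m -> m = 0.
Proof.
move=> /forall_inP h.
rewrite -(@sol_unique eps m 0); first by rewrite /sol mul0mx.
by move=> i; rewrite mxE; apply/eqP/h; rewrite inE.
Qed.

Lemma max_cone_maximal eps s : s \in cones X -> max_cone eps \subset s ->
  s = max_cone eps.
Proof.
move=> sX es; apply/eqP; rewrite finset.eqEsubset es andbT.
apply/fintype.subsetP => -[i e] rs; rewrite inE /=.
have := cone_sgn sX rs; have := cone_sgn sX (fintype.subsetP es (i, eps i) _).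
by rewrite inE eqxx => /(_ isT) /= -> ->.
Qed.

End LimitFan.

(** * Orbit closures and invariant curves *)

Lemma uniq_seq_of_infinite (T : eqType) (P : T -> Prop) :
  (forall l : seq T, exists2 x, x \notin l & P x) -> forall d,
  exists u : seq T, [/\ uniq u, size u = d & forall x, x \in u -> P x].
Proof.
move=> h; elim=> [|d [u [uu su hu]]]; first by exists [::].
have [x xu Px] := h u; exists (x :: u); split; rewrite /= ?xu ?su // => y.
by rewrite in_cons => /orP[/eqP->|/hu].
Qed.

Lemma poly_finite_roots (k : fieldType) (p : {poly k}) : p != 0 ->
  exists l : seq k, forall x, root p x -> x \in l.
Proof.
move=> p0; apply: contrapT => /forallNP h.
have inf (l : seq k) : exists2 x, x \notin l & root p x.
  by have /existsNP[x /not_implyP[px /negP xl]] := h l; exists x.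
have [u [uu su hu]] := uniq_seq_of_infinite inf (size p).
suff /(max_poly_roots p0)/(_ uu) : all (root p) u by rewrite su ltnn.
by apply/allP.
Qed.

Lemma poly_vanishing (k : fieldType)
    (kinf : forall l : seq k, exists x, x \notin l) (p : {poly k}) (l : seq k) :
  (forall x, x \notin l -> p.[x] = 0) -> p = 0.
Proof.
move=> h; have [//|/poly_finite_roots[l' hl']] := eqVneq p 0.
have [x] := kinf (l ++ l'); rewrite mem_cat negb_or => /andP[/h /rootP px].
by rewrite hl'.
Qed.

(** * Torus points and one-parameter subgroups *)

Section TorusCharacters.
Variables (k : fieldType) (r : nat).
Implicit Types (c : 'I_r -> k) (m : 'rV[int]_r).

Definition tchar c m : k := \prod_i c i ^ m 0 i.

Lemma tchar0 c : tchar c 0 = 1.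
Proof. by rewrite /tchar big1 // => i _; rewrite mxE. Qed.

Lemma tcharD c m m' : (forall i, c i != 0) ->
  tchar c (m + m') = tchar c m * tchar c m'.
Proof.
move=> c0; rewrite /tchar -big_split /=; apply: eq_bigr => i _.
by rewrite mxE expfzDr.
Qed.

Lemma tchar_neq0 c m : (forall i, c i != 0) -> tchar c m != 0.
Proof. by move=> c0; apply/prodf_neq0 => i _; rewrite expfz_neq0. Qed.

Lemma tchar_mul c c' m : tchar (fun i => c i * c' i) m = tchar c m * tchar c' m.
Proof.
by rewrite /tchar -big_split /=; apply: eq_bigr => i _; rewrite expfzMl.
Qed.

Lemma tchar_one_parameter (z : k) (u m : 'rV[int]_r) : z != 0 ->
  tchar (fun i => z ^ u 0 i) m = z ^ lpairing m u.
Proof.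
move=> z0; rewrite /tchar /lpairing.
elim/big_rec2: _ => [|i x y _ ->]; first by rewrite expr0z.
by rewrite expfzDr // exprz_exp [u 0 i * _]mulrC.
Qed.

Lemma tchar_universal (h : 'rV[int]_r -> k) :
  h 0 = 1 -> (forall m m', h (m + m') = h m * h m') ->
  forall m, h m = tchar (fun i => h (delta_mx 0 i)) m.
Proof.
move=> h0 hD m.
have hnz m' : h m' != 0.
  apply: contraTneq (oner_neq0 k) => e.
  by rewrite -h0 -(subrr m') hD e mul0r eqxx.
have hN m' : h (- m') = (h m')^-1.
  by apply: (mulfI (hnz m')); rewrite -hD subrr h0 divff.
have hMn m' d : h (m' *+ d) = h m' ^+ d.
  by elim: d => [|d IH]; rewrite ?mulr0n ?expr0 // mulrS exprS hD IH.
have hZ m' (z : int) : h (z *: m') = h m' ^ z.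
  rewrite -[z]intz scaler_int intz; case: z => d; first by rewrite -pmulrn hMn.
  by rewrite NegzE mulrNz -pmulrn hN hMn exprnN.
rewrite [in LHS](row_sum_delta m) /tchar.
by elim/big_rec2: _ => // i x y _ <-; rewrite hD hZ.
Qed.

End TorusCharacters.

Section LimitPoints.
Variables (k : fieldType) (b : nat -> nat -> int) (r : nat).
Local Notation X := (limit_fan b r).
Implicit Types (m v : 'rV[int]_r) (eps : 'I_r -> bool) (s t : {set ray X}).
Implicit Types (rho : ray X) (x y : tpoint k X) (Z : set (tpoint k X)).

Lemma tpoint_exists s (c : 'I_r -> k) : s \in cones X -> (forall i, c i != 0) ->
  exists x, cone_of x = s /\
    forall m, orthogonal_cone s m -> chi x m = tchar c m.
Proof.
move=> sX c0; pose f m := if orthogonal_cone s m then tchar c m else 0.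
have f_neq0 m : (f m != 0) = orthogonal_cone s m.
  by rewrite /f; case: ifP => _; rewrite ?tchar_neq0 // eqxx.
have f0 : f 0 = 1 by rewrite /f orthogonal0 tchar0.
have fD m m' : orthogonal_cone s m -> orthogonal_cone s m' ->
    f (m + m') = f m * f m'.
  by move=> o o'; rewrite /f orthogonalD // o o' tcharD.
by exists (TPoint sX f_neq0 f0 fD); split => //= m o; rewrite /f o.
Qed.

(** The orthogonal lattice of a cone is a direct summand, so the morphism defining the point extends
    to all characters, that is, to a point of the torus. *)
Lemma tpoint_tchar x : exists2 c : 'I_r -> k, (forall i, c i != 0) &
  forall m, orthogonal_cone (cone_of x) m -> chi x m = tchar c m.
Proof.
set s := cone_of x; have sX : s \in cones X := cone_ofP x.
pose eps := sgn s.
(* A retraction onto the orthogonal lattice: values on the rays of [s] become zero, those on the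
   completing rays are kept. *)
pose P m : 'rV[int]_r :=
  sol b eps (\row_i if (i, eps i) \in s then 0 else lpairing m (gen b (i, eps i))).
have Po m : orthogonal_cone s (P m).
  apply/forall_inP => -[i e] rs; have := cone_sgn sX rs => /= ee; subst e.
  by rewrite [lpairing _ _]sol_pairing mxE rs.
have PK m : orthogonal_cone s m -> P m = m.
  move=> /forall_inP o; apply: sol_unique => i; rewrite mxE.
  by case: ifP => // rs; apply/eqP/o.
have PD m m' : P (m + m') = P m + P m'.
  rewrite /P -solD; congr sol; apply/rowP => i; rewrite !mxE lpairingDl.
  by case: ifP; rewrite ?addr0.
have P0 : P 0 = 0 by apply: PK; apply: orthogonal0.
exists (fun i => chi x (P (delta_mx 0 i))) => [i|m o].
  by rewrite chi_neq0; apply: Po.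
rewrite -(@tchar_universal _ _ (chi x \o P)) /= ?P0 ?chi0 ?PK //.
by move=> m1 m2; rewrite PD chiD //; apply: Po.
Qed.

Lemma tpoint_eq x y : cone_of x = cone_of y ->
  (forall m, orthogonal_cone (cone_of x) m -> chi x m = chi y m) -> x = y.
Proof.
move=> e h; apply: tpoint_ext => // m.
have [/h//|o] := boolP (orthogonal_cone (cone_of x) m).
by rewrite !chi_eq0 // -e.
Qed.

(** Points of a chart are separated by its coordinate ring; the characters [dvec t rho] already
    detect the cone. *)
Lemma dual_determines x y t : t \in cones X -> cone_of x \subset t ->
  cone_of y \subset t -> (forall m, dual_cone t m -> chi x m = chi y m) ->
  x = y.
Proof.
move=> tX xt yt h.
have e : cone_of x = cone_of y.
  apply/setP => rho; have [rt|rt] := boolP (rho \in t); last first.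
    rewrite (contraNF (fintype.subsetP xt rho)) //.
    by rewrite (contraNF (fintype.subsetP yt rho)).
  apply: negb_inj; rewrite -!(dvec_orthogonal rho tX) // -!chi_neq0.
  by rewrite h // dvec_dual.
apply: tpoint_eq => // m o.
(* A character orthogonal to [cone_of x] may be negative on other rays of [t]; [m'] is orthogonal
   too and large enough that [m] becomes a difference of elements of the dual cone. *)
pose m' := csol t [ffun rho => if rho \in cone_of x then 0
                               else `|lpairing m (gen b rho)|].
have m'E rho : rho \in t -> lpairing m' (gen b rho) =
    if rho \in cone_of x then 0 else `|lpairing m (gen b rho)|.
  by move=> rt; rewrite csol_pairing // ffunE.
have m'o : orthogonal_cone (cone_of x) m'.
  apply/forall_inP => rho rs; rewrite [lpairing _ _]m'E ?rs //.
  exact: fintype.subsetP rs.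
have m'd : dual_cone t m'.
  apply/forall_inP => rho rt; rewrite [lpairing _ _]m'E //.
  by case: ifP => // _; apply: normr_ge0.
have mm'd : dual_cone t (m + m').
  apply/forall_inP => rho rt; rewrite lpairingDl [X in _ + X]m'E //.
  case: ifP => [rs|_]; last first.
    have := ler_norm (- lpairing m (gen b rho)).
    by rewrite normrN -subr_ge0 opprK addrC.
  by rewrite (eqP (forall_inP o _ rs)).
have := h _ mm'd; rewrite !chiD -?e // (h m') // => /mulIf; apply.
by rewrite chi_neq0 -e.
Qed.

Lemma closed1 x : zariski_closed [set x].
Proof.
move=> t tX; have [xt|xt] := boolP (cone_of x \subset t); last first.
  (* The constant 1 as only equation: the chart misses the set. *)
  exists [set [:: (1, 0)]].
    by move=> a ->; rewrite regular1; apply/orthogonal_dual/orthogonal0.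
  move=> y yt; split => [e|/(_ _ erefl) /eqP].
    by case/negP: xt; rewrite -[x]e.
  by rewrite eval1 chi0 mulr1 oner_eq0.
exists [set a | regular t a /\ eval a x = 0]; first by move=> a [].
move=> y yt; split => [-> a [] //|h].
apply: (@dual_determines y x t) => // m md.
have o0 : orthogonal_cone t 0 by apply: orthogonal0.
pose a : laurent k r := [:: (1, m); (- chi x m, 0)].
have ev z : eval a z = chi z m - chi x m.
  by rewrite /eval !big_cons big_nil chi0 /= addr0 mulr1 mul1r.
have ra : regular t a by rewrite /regular /= md orthogonal_dual.
have /(_ (conj ra _)) : regular t a /\ eval a x = 0 -> eval a y = 0 := h a.
by rewrite !ev subrr => /(_ erefl) /subr0_eq.
Qed.

Lemma closed_subsingleton Z : (forall x y, Z x -> Z y -> x = y) ->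
  zariski_closed Z.
Proof.
move=> h; have [[x Zx]|/set0P/negP/negPn/eqP ->] := pselect (Z !=set0).
  rewrite (_ : Z = [set x]); first exact: closed1.
  by apply/seteqP; split => [y Zy|y ->] //; apply: h.
exact: closed_set0.
Qed.

Definition orbit_closure s : set (tpoint k X) := [set x | s \subset cone_of x].

(** In a chart that contains the orbit of [s], the closure is the common zero locus of the
    coordinates dual to the rays of [s]. *)
Lemma closed_orbit_closure s : s \in cones X -> zariski_closed (orbit_closure s).
Proof.
move=> sX t tX; have [st|st] := boolP (s \subset t); last first.
  exists [set [:: (1, 0)]].
    by move=> a ->; rewrite regular1; apply/orthogonal_dual/orthogonal0.
  move=> y yt; split => [e|/(_ _ erefl) /eqP].
    by case/negP: st; apply: fintype.subset_trans yt.
  by rewrite eval1 chi0 mulr1 oner_eq0.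
exists [set a | exists2 rho, rho \in s & a = [:: (1, dvec t rho)]].
  by move=> _ [rho _ ->]; rewrite regular1 dvec_dual.
move=> y yt; split => [sy _ [rho rs ->]|h].
  rewrite eval1 chi_eq0 ?mulr0 // dvec_orthogonal // negbK.
  exact: fintype.subsetP rs.
apply/fintype.subsetP => rho rs.
have := h _ (ex_intro2 _ _ rho rs erefl); rewrite eval1 mul1r => /eqP.
by rewrite -[_ == 0]negbK chi_neq0 dvec_orthogonal // negbK.
Qed.

Hypothesis kinf : forall l : seq k, exists z, z \notin l.

(* A point x of a smaller orbit is the limit at 0 of a translate of a
   one-parameter subgroup in the orbit of s. *)
Lemma orbit_closure_sub s Z : s \in cones X -> zariski_closed Z ->
  (forall x, cone_of x = s -> Z x) -> orbit_closure s `<=` Z.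
Proof.
move=> sX cZ hZ x sx; set t := cone_of x.
have tX : t \in cones X := cone_ofP x.
have [F rF hF] := cZ t tX; apply/(hF x); first exact: fintype.subxx.
move=> a Fa; have ra := rF a Fa.
have [c c0 xc] := tpoint_tchar x.
(* An interior direction of [t] modulo [s]: in the dual cone of [t], a character orthogonal to [s]
   kills [w] exactly when it is orthogonal to [t]. *)
pose w : 'rV[int]_r := \sum_(rho in t :\: s) gen b rho.
have wE m : lpairing m w = \sum_(rho in t :\: s) lpairing m (gen b rho).
  rewrite /lpairing exchange_big /=; apply: eq_bigr => i _.
  by rewrite /w summxE mulr_sumr.
have w_ge0 m : dual_cone t m -> 0 <= lpairing m w.
  move=> /forall_inP md; rewrite wE sumr_ge0 // => rho.
  by rewrite inE => /andP[_ /md].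
have w_eq0 m : dual_cone t m ->
    orthogonal_cone t m = orthogonal_cone s m && (lpairing m w == 0).
  move=> /forall_inP md; apply/idP/andP => [o|[/forall_inP os]].
    split; first exact: orthogonal_subset o.
    rewrite wE big1 // => rho; rewrite inE => /andP[_ /(forall_inP o)].
    by move/eqP.
  rewrite wE psumr_eq0 => [/allP h|rho]; last first.
    by rewrite inE => /andP[_ /md].
  apply/forall_inP => rho rt; have [/os//|rs] := boolP (rho \in s).
  by have := h rho (mem_index_enum _); rewrite inE rs rt.
(* The restriction of [a] to the points [c z^w] of the orbit of [s]. It vanishes for all nonzero
   [z], and its value at 0 is [eval a x]. *)
pose p : {poly k} := \sum_(u <- a)
  (if orthogonal_cone s u.2 then u.1 * tchar c u.2 else 0) *:
    'X^(absz (lpairing u.2 w)).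
have p0 : p = 0.
  apply: (poly_vanishing kinf (l := [:: 0])) => z; rewrite inE => z0.
  have cz0 i : c i * z ^ w 0 i != 0 by rewrite mulf_neq0 // expfz_neq0.
  have [y [ys yc]] := tpoint_exists sX cz0.
  have yt : chart t y by rewrite /chart /= ys.
  have /(hF y yt)/(_ a Fa) <- : Z y by apply: hZ.
  rewrite /p horner_sum /eval big_seq [RHS]big_seq; apply: eq_bigr => u ua.
  rewrite hornerZ hornerXn; case: ifPn => o; last first.
    by rewrite chi_eq0 ?ys // mul0r mulr0.
  rewrite yc // tchar_mul tchar_one_parameter // mulrA; congr (_ * _).
  have := w_ge0 _ (allP ra u ua).
  by case: (lpairing _ _).
have := congr1 (horner^~ 0) p0; rewrite horner0 => <-.
rewrite /p horner_sum /eval big_seq [RHS]big_seq; apply: eq_bigr => u ua.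
rewrite hornerZ hornerXn expr0n absz_eq0.
have ut := allP ra u ua.
have := w_eq0 _ ut; case: ifPn => _ /=; last first.
  by move=> o; rewrite mul0r chi_eq0 ?mulr0 // o.
case: eqP => _ o; last by rewrite mulr0 chi_eq0 ?mulr0 // o.
by rewrite mulr1 xc.
Qed.

End LimitPoints.

(** * Wall curves and the classification of invariant curves *)

Section Walls.
Variables (k : fieldType) (b : nat -> nat -> int) (r : nat).
Local Notation X := (limit_fan b r).
Local Notation V := (@orbit_closure k b r).
Implicit Types (m v : 'rV[int]_r) (eps : 'I_r -> bool) (s t : {set ray X}).
Implicit Types (rho : ray X) (x y : tpoint k X) (Z : set (tpoint k X)).

Definition max_cone_point eps : set (tpoint k X) :=
  [set x | cone_of x = max_cone b eps].

Lemma max_cone_point_eq eps x y :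
  max_cone_point eps x -> max_cone_point eps y -> x = y.
Proof.
move=> ex ey; apply: tpoint_eq; first by rewrite ex ey.
by rewrite ex => m /max_cone_orthogonal ->; rewrite !chi0.
Qed.

Lemma ones_neq0 : forall i : 'I_r, (1 : k) != 0.
Proof. by move=> _; apply: oner_neq0. Qed.

Lemma tpoint_of s : s \in cones X -> exists x, cone_of x = s.
Proof. by move=> sX; have [x []] := tpoint_exists sX ones_neq0; exists x. Qed.

Lemma orbit_closure_max eps : V (max_cone b eps) = max_cone_point eps.
Proof.
apply/seteqP; split => x; last by move=> ex; rewrite /orbit_closure /= ex.
by move=> /(max_cone_maximal (cone_ofP x)).
Qed.

Lemma irreducible_max_cone_point eps : irreducible_closed (max_cone_point eps).
Proof.
have [x ex] := tpoint_of (max_coneX b eps).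
rewrite (_ : max_cone_point eps = [set x]).
  exact/irreducible1/closed1.
apply/seteqP; split => [y ey|y ->] //; exact: max_cone_point_eq ey ex.
Qed.

Definition set_sign eps (i : 'I_r) (e : bool) : 'I_r -> bool :=
  fun j => if j == i then e else eps j.

Lemma wall_set_sign eps i e : wall b (set_sign eps i e) i = wall b eps i.
Proof.
apply/setP => rho; rewrite !inE /set_sign.
by have [_|ne] := eqVneq rho.1 i; rewrite ?andbF.
Qed.

Lemma cone_over_wall eps i s : s \in cones X -> wall b eps i \subset s ->
  s = wall b eps i \/ exists e, s = max_cone b (set_sign eps i e).
Proof.
move=> sX ws.
have sE j : j != i -> sgn s j = eps j.
  move=> ji; have : (j, eps j) \in s.
    by apply: (fintype.subsetP ws); rewrite inE eqxx.
  by move=> /(cone_sgn sX) /= ->.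
have [is_|nis] := boolP ((i, sgn s i) \in s); [right|left].
  exists (sgn s i); apply: max_cone_maximal => //.
  apply/fintype.subsetP => -[j e]; rewrite inE /set_sign /= => /eqP ->.
  have [->//|ji] := eqVneq j i.
  by apply: (fintype.subsetP ws); rewrite inE eqxx.
apply/eqP; rewrite finset.eqEsubset ws andbT; apply/fintype.subsetP => -[j e] rs.
have /= ee := cone_sgn sX rs; subst e.
have [ji|ji] := eqVneq j i; first by rewrite -ji rs in nis.
by rewrite inE /= ji sE ?eqxx.
Qed.

Lemma max_cone_point_wall eps i :
  max_cone_point eps `<` V (wall b eps i).
Proof.
rewrite -orbit_closure_max; split => [x|h].
  by apply: fintype.subset_trans; apply: wall_sub.
have [x ex] := tpoint_of (wallX b eps i).
have := h x; rewrite /orbit_closure /= ex => /(_ (fintype.subxx _)).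
move=> /fintype.subsetP/(_ (i, eps i)).
by rewrite !inE !eqxx => /(_ isT).
Qed.

Section Coordinate.
Variables (eps : 'I_r -> bool) (i : 'I_r).
Let w := wall b eps i.
(** Generator of the orthogonal lattice of the wall; its character is the coordinate on the
    one-dimensional orbit. *)
Let e := sol b eps (delta_mx 0 i).

Lemma wall_coordinate_orthogonal : orthogonal_cone w e.
Proof.
apply/forall_inP => -[j s]; rewrite inE /= => /andP[/eqP-> ji].
by rewrite [lpairing _ _]sol_pairing mxE (negPf ji) andbF.
Qed.

Lemma wall_orthogonalE m : orthogonal_cone w m ->
  m = lpairing m (gen b (i, eps i)) *: e.
Proof.
move=> /forall_inP o.
rewrite /e /sol scalemxAl; symmetry; apply: sol_unique => j; rewrite !mxE eqxx /=.
have [->|ji] := eqVneq j i; first by rewrite mulr1.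
rewrite mulr0; apply/eqP/(o (j, eps j)).
by rewrite inE eqxx.
Qed.

Lemma chi_scale x (d : nat) m : dual_cone (cone_of x) m ->
  chi x (d%:Z *: m) = chi x m ^+ d.
Proof.
move=> md; suff [] : dual_cone (cone_of x) (d%:Z *: m) /\
    chi x (d%:Z *: m) = chi x m ^+ d by [].
elim: d => [|d [IH1 IH2]].
  by rewrite scale0r chi0 expr0; split => //; apply/orthogonal_dual/orthogonal0.
by rewrite intS scalerDl scale1r chi_dualD // IH2 exprS; split => //; apply: dualD.
Qed.

Lemma wall_point_eq x y : cone_of x = w -> cone_of y = w ->
  chi x e = chi y e -> x = y.
Proof.
move=> ex ey xy; apply: tpoint_eq; first by rewrite ex.
move=> m; rewrite ex => /wall_orthogonalE ->.
have ox := wall_coordinate_orthogonal; rewrite -ex in ox.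
have oy := wall_coordinate_orthogonal; rewrite -ey in oy.
case: (lpairing _ _) => d; first by rewrite !chi_scale ?xy // orthogonal_dual.
rewrite NegzE scaleNr -scalerN !chi_scale; last 2 first.
- exact/orthogonal_dual/orthogonalN.
- exact/orthogonal_dual/orthogonalN.
congr (_ ^+ _); apply: (@mulfI _ (chi x e)); first by rewrite chi_neq0.
rewrite -chiD ?orthogonalN // subrr xy -chiD ?orthogonalN // subrr.
by rewrite !chi0.
Qed.

Lemma wall_point_exists (z : k) : z != 0 ->
  exists2 x, cone_of x = w & chi x e = z.
Proof.
move=> z0; pose u := gen b (i, eps i).
have c0 (j : 'I_r) : z ^ u 0 j != 0 by rewrite expfz_neq0.
have [x [ex xc]] := tpoint_exists (wallX b eps i) c0.
exists x => //; rewrite xc ?wall_coordinate_orthogonal //.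
by rewrite tchar_one_parameter // sol_pairing mxE !eqxx expr1z.
Qed.

Hypothesis kinf : forall l : seq k, exists z, z \notin l.

(** On the orbit of the wall the equations of [Z] become polynomials in [chi x e]. Either all are
    zero and [Z] contains the orbit, hence its closure, or a nonzero one has finitely many roots. *)
Lemma wall_closed_dichotomy Z : zariski_closed Z ->
  V w `<=` Z \/
  exists l : seq k, forall x, cone_of x = w -> Z x -> chi x e \in l.
Proof.
move=> cZ; have [F rF hF] := cZ _ (max_coneX b eps).
pose p (a : laurent k r) : {poly k} := \sum_(u <- a)
  (if orthogonal_cone w u.2 then u.1 else 0) *:
    'X^(absz (lpairing u.2 (gen b (i, eps i)))).
have pE a x : F a -> cone_of x = w -> eval a x = (p a).[chi x e].
  move=> Fa ex; rewrite /p horner_sum /eval big_seq [RHS]big_seq.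
  apply: eq_bigr => u ua; rewrite hornerZ hornerXn.
  case: ifPn => o; last by rewrite chi_eq0 ?ex // mul0r mulr0.
  congr (_ * _); rewrite {1}(wall_orthogonalE o).
  have /forall_inP/(_ (i, eps i)) := allP (rF a Fa) u ua.
  rewrite inE eqxx => /(_ isT); rewrite /gen /=.
  case: (lpairing _ _) => // d _; rewrite chi_scale // ex orthogonal_dual //.
  exact: wall_coordinate_orthogonal.
have wchart x : cone_of x = w -> chart (max_cone b eps) x.
  by move=> ex; rewrite /chart /= ex wall_sub.
have [p0|/existsNP[a /not_implyP[Fa /eqP pa]]] :=
    pselect (forall a, F a -> p a = 0).
  left; apply: orbit_closure_sub => //; first exact: wallX.
  move=> x ex; apply/(hF x (wchart x ex)) => a Fa.
  by rewrite (pE a x) // p0 // horner0.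
right; have [l hl] := poly_finite_roots pa; exists l => x ex Zx.
by apply: hl; rewrite /root -pE //; apply/eqP; apply: (hF x (wchart x ex)).1.
Qed.

Lemma irreducible_wall : irreducible_closed (V w).
Proof.
split.
- exact/closed_orbit_closure/wallX.
- have [x ex] := tpoint_of (wallX b eps i); exists x.
  by rewrite /orbit_closure /= ex.
move=> A B /wall_closed_dichotomy [|[lA hA]]; first by left.
move=> /wall_closed_dichotomy [|[lB hB]]; first by right.
have [z] := kinf (0 :: lA ++ lB).
rewrite in_cons mem_cat !negb_or => /and3P[z0 zA zB].
have [x ex xz] := wall_point_exists z0.
case/(_ x) => [|/(hA x ex)|/(hB x ex)]; rewrite ?xz ?(negPf zA) ?(negPf zB) //.
by rewrite /orbit_closure /= ex.
Qed.

(** A proper closed subset is finite: some points of the orbit and at most two fixed points. If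
    irreducible it is a single point, with no irreducible set strictly inside. *)
Lemma wall_curve : is_curve (V w).
Proof.
split; first exact: irreducible_wall.
  exists (max_cone_point eps); first exact: irreducible_max_cone_point.
  exact: max_cone_point_wall.
move=> Z0 Z1 [_ [x Z0x] _] irr1 [Z01 nZ10] [Z1w nwZ1]; apply: nZ10.
have [cZ1 _ _] := irr1.
have [//|[l hl]] := wall_closed_dichotomy cZ1.
(* [inl z] stands for the orbit point of coordinate [z], [inr s] for the fixed point with sign [s]
   at [i]. *)
pose A (j : k + bool) : set (tpoint k X) :=
  match j with
  | inl z => [set x | cone_of x = w /\ chi x e = z]
  | inr s => max_cone_point (set_sign eps i s)
  end.
have Asub j x1 x2 : A j x1 -> A j x2 -> x1 = x2.
  case: j => [z [e1 x1z] [e2 x2z]|s]; last exact: max_cone_point_eq.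
  by apply: wall_point_eq => //; rewrite x1z.
have [||j _ Z1A y Z1y] := @irreducible_bigU _ _ _ _
    ([seq inl z | z <- l] ++ [:: inr true; inr false]) A _ irr1.
- by move=> j _; apply/closed_subsingleton/Asub.
- move=> y Z1y; have [ey|[s ey]] := cone_over_wall (cone_ofP y) (Z1w y Z1y).
    by exists (inl (chi y e)) => //; rewrite mem_cat map_f ?hl.
  by exists (inr s); rewrite // mem_cat !inE; case: s ey => _; rewrite ?eqxx ?orbT.
by rewrite (Asub j y x) //; apply: Z1A => //; apply: Z01.
Qed.

End Coordinate.

Hypothesis kinf : forall l : seq k, exists z, z \notin l.

(** The torus is transitive on each orbit: the quotient of torus points lifting [y] and [x] moves
    [x] to [y]. *)
Lemma torus_invariant_orbit Z x y :
  torus_invariant Z -> cone_of y = cone_of x -> Z x -> Z y.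
Proof.
move=> tZ yx; have [c c0 xc] := tpoint_tchar x.
have [d d0 yd] := tpoint_tchar y.
apply: (tZ (fun i => d i * (c i)^-1) _ x y yx) => [i|m].
  by rewrite mulf_neq0 ?invr_eq0.
rewrite -/(tchar _ m); have [o|o] := boolP (orthogonal_cone (cone_of x) m).
  rewrite xc // yd ?yx // -tchar_mul; apply: eq_bigr => i _.
  by rewrite divfK.
by rewrite !chi_eq0 ?yx // mulr0.
Qed.

(** Invariance makes [Z] a finite union of orbit closures, and irreducibility leaves a single [V s].
    If [s] were maximal, [Z] would be a point; if [s] were strictly inside a wall, a fixed point and
    the wall curve would form too long a chain below [Z]. *)
Lemma torus_invariant_curve (Z : curve k X) : torus_invariant Z ->
  exists eps i, carrier Z = V (wall b eps i).
Proof.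
move: (curveP Z); move: (carrier Z) => {}Z.
move=> [irrZ [Z0 [_ [x0 Z0x0] _] [Z0Z nZZ0]] dimZ] tZ.
have [cZ _ _] := irrZ.
pose l := [seq s <- enum (cones X) | `[< V s `<=` Z >]].
have lP s : s \in l -> s \in cones X /\ V s `<=` Z.
  by rewrite mem_filter mem_enum => /andP[/asboolP].
have [||s /lP[sX sZ] Zs] := @irreducible_bigU _ _ _ _ l V _ irrZ.
- by move=> s /lP[sX _]; apply: closed_orbit_closure.
- move=> x Zx; exists (cone_of x); last exact: fintype.subxx.
  rewrite mem_filter mem_enum cone_ofP andbT; apply/asboolP.
  apply: orbit_closure_sub => //; first exact: cone_ofP.
  by move=> y yx; apply: torus_invariant_orbit Zx.
have ZE : Z = V s by apply/seteqP.
have [i nis] : exists i, (i, sgn s i) \notin s.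
  apply: contrapT => /forallNP h; apply: nZZ0.
  have sm : max_cone b (sgn s) \subset s.
    apply/fintype.subsetP => -[i e]; rewrite inE /= => /eqP ->.
    by apply/negPn/negP; apply: h.
  have := max_cone_maximal sX sm => sE.
  move=> x; rewrite ZE sE orbit_closure_max => xm.
  suff -> : x = x0 by [].
  apply: max_cone_point_eq xm _; rewrite -orbit_closure_max -sE.
  exact/Zs/Z0Z.
have sw : s \subset wall b (sgn s) i.
  apply/fintype.subsetP => -[j e] rs; have /= ee := cone_sgn sX rs.
  rewrite inE /= ee eqxx; apply: contraNneq nis => <-.
  by rewrite -ee.
exists (sgn s), i; rewrite ZE.
have [<-//|sne] := eqVneq s (wall b (sgn s) i).
case: (@dimZ (max_cone_point (sgn s)) (V (wall b (sgn s) i))).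
- exact: irreducible_max_cone_point.
- exact: irreducible_wall.
- exact: max_cone_point_wall.
- rewrite ZE; split => [x|h]; first exact: fintype.subset_trans.
  have [x ex] := tpoint_of sX.
  have := h x; rewrite /orbit_closure /= ex => /(_ (fintype.subxx _)) ws.
  by case/eqP: sne; apply/eqP; rewrite finset.eqEsubset sw.
Qed.

End Walls.

(** * The curves L_I *)

Section Fibration.
Variables (k : fieldType) (b : nat -> nat -> int).

Section Step.
Variable j : nat.
Local Notation X := (limit_fan b j).
Local Notation X' := (limit_fan b j.+1).
Implicit Types (m : 'rV[int]_j) (s : {set ray X'}) (x : tpoint k X')
  (y : tpoint k X).

Lemma extend0_lift m (i : 'I_j) : extend0 m 0 (lift ord_max i) = m 0 i.
Proof. by rewrite mxE liftK. Qed.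

Lemma extend0_max m : extend0 m 0 ord_max = 0.
Proof. by rewrite mxE unlift_none. Qed.

Lemma extend0D m m' : extend0 (m + m') = extend0 m + extend0 m'.
Proof.
apply/rowP => i; have [l ->|->] := unliftP ord_max i.
  by rewrite [RHS]mxE !extend0_lift mxE.
by rewrite [RHS]mxE !extend0_max addr0.
Qed.

Lemma extend00 : extend0 (0 : 'rV[int]_j) = 0.
Proof.
apply/rowP => i; have [l ->|->] := unliftP ord_max i.
  by rewrite extend0_lift !mxE.
by rewrite extend0_max mxE.
Qed.

Lemma lpairing_extend0 m (i : 'I_j) (e : bool) :
  lpairing (extend0 m) (gen b (lift ord_max i, e)) = lpairing m (gen b (i, e)).
Proof.
rewrite !lpairing_gen extend0_lift; case: e => //; congr (_ - _).
rewrite big_mkcond big_ord_recr /= extend0_max mulr0 if_same addr0.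
rewrite [RHS]big_mkcond; apply: eq_bigr => l _.
have -> : widen_ord (leqnSn j) l = lift ord_max l.
  by apply: val_inj; rewrite [RHS]lift_max.
have bumpE (l' : 'I_j) : bump j l' = l' by rewrite /bump leqNgt ltn_ord.
by rewrite extend0_lift /= !bumpE.
Qed.

Lemma lpairing_extend0_max m (e : bool) :
  lpairing (extend0 m) (gen b (ord_max, e)) = 0.
Proof.
rewrite lpairing_gen extend0_max big1 => [|l]; first by case: e; rewrite ?subr0.
by rewrite ltnNge leq_ord.
Qed.

(** The two rays of last index lie in the kernel of the projection; every other ray goes to the ray
    of the same name. *)
Definition project_cone s : {set ray X} :=
  [set rho : ray X | ((lift ord_max rho.1, rho.2) : ray X') \in s].

Lemma project_coneX s : s \in cones X' -> project_cone s \in cones X.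
Proof.
move=> /cone_sgnP [eps h]; apply/cone_sgnP; exists (fun i => eps (lift ord_max i)).
by move=> [i e]; rewrite inE => /h.
Qed.

Lemma orthogonal_extend0 s m :
  orthogonal_cone s (extend0 m) = orthogonal_cone (project_cone s) m.
Proof.
apply/forall_inP/forall_inP => h [i e]; rewrite ?inE => rs.
  by have := h _ rs; rewrite [lpairing _ _]lpairing_extend0.
have [l il|ie] := unliftP ord_max i.
  rewrite il [lpairing _ _]lpairing_extend0; apply: (h (l, e)).
  by rewrite inE -il.
by rewrite ie [lpairing _ _]lpairing_extend0_max.
Qed.

Lemma dual_extend0 s m :
  dual_cone s (extend0 m) = dual_cone (project_cone s) m.
Proof.
apply/forall_inP/forall_inP => h [i e]; rewrite ?inE => rs.
  by have := h _ rs; rewrite [lpairing _ _]lpairing_extend0.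
have [l il|ie] := unliftP ord_max i.
  rewrite il [lpairing _ _]lpairing_extend0; apply: (h (l, e)).
  by rewrite inE -il.
by rewrite ie [lpairing _ _]lpairing_extend0_max.
Qed.

Lemma fibration_total x : exists y, fibration x y.
Proof.
pose s := project_cone (cone_of x).
have sX : s \in cones X := project_coneX (cone_ofP x).
have f_neq0 m : (chi x (extend0 m) != 0) = orthogonal_cone s m.
  by rewrite chi_neq0 orthogonal_extend0.
have f0 : chi x (extend0 0) = 1 by rewrite extend00 chi0.
have fD m m' : orthogonal_cone s m -> orthogonal_cone s m' ->
    chi x (extend0 (m + m')) = chi x (extend0 m) * chi x (extend0 m').
  by move=> o o'; rewrite extend0D chiD // orthogonal_extend0.
by exists (TPoint sX f_neq0 f0 fD) => m /= md; rewrite dual_extend0.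
Qed.

(** [fibration] constrains only characters in the dual cone of [y]. Biduality gives one inclusion;
    for the other, the character dual to an extra ray would vanish at [y] while its pullback does
    not vanish at [x]. *)
Lemma fibration_cone x y :
  fibration x y -> cone_of y = project_cone (cone_of x).
Proof.
move=> xy; have yX := cone_ofP y.
have sX := project_coneX (cone_ofP x).
have sub : project_cone (cone_of x) \subset cone_of y.
  by apply: dual_cone_le => // m /xy []; rewrite dual_extend0.
apply/eqP; rewrite finset.eqEsubset sub andbT; apply/fintype.subsetP => rho ry.
apply: contraT => rs.
have [_ e] := xy _ (dvec_dual rho yX).
have : chi y (dvec (cone_of y) rho) != 0.
  by rewrite e chi_neq0 orthogonal_extend0 dvec_orthogonal.
by rewrite chi_neq0 dvec_orthogonal // ry.
Qed.

End Step.

(** A point lies on the curve exactly when its cone has the prescribed ray at each index other than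
    [i]. The Schubert point prescribes [true] below [i] and each section prescribes the sign of its
    own index, so the condition climbs the tower one coordinate at a time. *)
Lemma curve_of_wall (i : nat) (I : seq nat) (r : nat) (ir : (i < r)%N) :
  all (fun l => i < l)%N I ->
  @curve_of k b (i :: I) r =
  @orbit_closure k b r
    (wall b (fun l : 'I_r => nat_of_ord l \notin i :: I) (Ordinal ir)).
Proof.
move=> /allP hI; set J := i :: I.
have Jge l : (l < i)%N -> l \notin J.
  move=> li; rewrite in_cons (ltn_eqF li) /=; apply/negP => /hI.
  by rewrite ltnNge (ltnW li).
suff H (x : tpoint k (limit_fan b r)) : curve_of J x <->
    forall l : 'I_r, nat_of_ord l != i -> (l, nat_of_ord l \notin J) \in cone_of x.
  apply/seteqP; split => x.
    move=> /H h; apply/fintype.subsetP => -[l e]; rewrite inE /=.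
    by case/andP => /eqP -> li; apply: h.
  move=> /fintype.subsetP h; apply/H => l li; apply: h.
  by rewrite inE eqxx.
elim: r ir x => // j IH ij x.
have lift_neq (l : 'I_j.+1) : nat_of_ord l != j -> exists l', l = lift ord_max l'.
  by have [l' ->|->] := unliftP ord_max l; [exists l'|rewrite eqxx].
have lift_val (l : 'I_j) : nat_of_ord (lift ord_max l) = l.
  by rewrite lift_max.
rewrite /curve_of -/curve_of /=; have [ji|ji] := eqVneq j i.
  split.
    move=> [y /= yS /fibration_cone yx] l li.
    have := li; rewrite -ji => /lift_neq [l' ll']; subst l.
    rewrite Jge ?lift_val -?ji ?ltn_ord //.
    have : (l', true) \in cone_of y by rewrite yS inE.
    by rewrite yx inE.
  move=> h; have [y xy] := fibration_total x; exists y => //.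
  have := fibration_cone xy; rewrite /schubert_point /= => yE.
  rewrite (@max_cone_maximal b _ (fun=> true) (cone_of y)) ?cone_ofP //.
    by apply/setP => -[l []]; rewrite !inE.
  apply/fintype.subsetP => -[l e]; rewrite inE /= => /eqP ->.
  rewrite yE inE /=; have := h (lift ord_max l); rewrite lift_val Jge ?ltn_ord //.
    by apply; rewrite -ji neq_ltn ltn_ord.
  by rewrite -ji.
have ltij : (i < j)%N by rewrite ltn_neqAle eq_sym ji -ltnS.
split.
  move=> [y /(IH ltij) hy [xj /fibration_cone yx]] l li.
  have [l' ll'|le] := unliftP ord_max l; last by rewrite le.
  have := hy l'; rewrite yx inE /= -ll' -(lift_val l') -ll'; exact.
move=> h; have [y xy] := fibration_total x; exists y.
  apply/(IH ltij) => l li; rewrite (fibration_cone xy) inE /=.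
  by have := h (lift ord_max l); rewrite lift_val; apply.
by split => //; apply: (h ord_max).
Qed.

End Fibration.

(** * Divisors and intersection numbers *)

Lemma divf_mul_inv (F : fieldType) (x y : F) : x != 0 -> y != 0 ->
  (x / y) * (y / x) = 1.
Proof. by move=> x0 y0; rewrite mulrA divfK // divff. Qed.

Lemma divf_mul_cancel (F : fieldType) (x y : F) : y != 0 -> x = y * (x / y).
Proof. by move=> y0; rewrite mulrC divfK. Qed.

Section CartierAlgebra.
Variables (k : fieldType) (n : nat) (X : fan n).
Implicit Types (D E : cartier k X) (s t : {set ray X}) (f g : ratfun k n).

Lemma regular_onM s f g : regular_on s f -> regular_on s g ->
  regular_on s (f * g).
Proof.
move=> [a ra ->] [a' ra' ->]; exists (lmul a a'); first exact: regular_mul.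
by rewrite ratfun_of_mul.
Qed.

Lemma regular_on_term s (c : k) m : dual_cone s m ->
  regular_on s (ratcst n c * ratmon k m).
Proof. by move=> md; exists [:: (c, m)]; rewrite ?regular1 ?ratfun_of1. Qed.

Lemma regular_on_mon s m : dual_cone s m -> regular_on s (ratmon k m).
Proof.
move=> md; rewrite -[ratmon k m]mul1r -ratcst1; exact: regular_on_term.
Qed.

Lemma regular_on_dual s (c : k) m : c != 0 ->
  regular_on s (ratcst n c * ratmon k m) -> dual_cone s m.
Proof.
move=> c0 [a /allP ra e].
have := @ratfun_of_inj _ _ [:: (c, m)] a.
rewrite ratfun_of1 => /(_ e (fun m' => (m' == m)%:R)).
rewrite big_seq1 /= eqxx mulr1 => ce; apply: contraNT c0 => md; rewrite ce.
rewrite big1_seq // => u /andP[_ /ra ud].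
by rewrite (_ : (u.2 == m) = false) ?mulr0 //; apply: contraNF md => /eqP <-.
Qed.

Lemma cartier_principal f : f != 0 ->
  exists D, forall s, s \in cones X -> equation D s = f.
Proof.
move=> f0; have h0 s : s \in cones X -> (fun=> f) s != 0 by [].
have h1 s t : s \in cones X -> t \in cones X ->
    regular_on (s :&: t) ((fun=> f) s / (fun=> f) t).
  move=> _ _; rewrite divff // -(ratmon0 k n); apply: regular_on_mon.
  exact/orthogonal_dual/orthogonal0.
by exists (Cartier h0 h1).
Qed.

Lemma cartier_mul D E : exists F,
  forall s, s \in cones X -> equation F s = equation D s * equation E s.
Proof.
have h0 s : s \in cones X -> equation D s * equation E s != 0.
  by move=> sX; rewrite mulf_neq0 ?equation_neq0.
have h1 s t : s \in cones X -> t \in cones X -> regular_on (s :&: t)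
    (equation D s * equation E s / (equation D t * equation E t)).
  move=> sX tX; rewrite -mulf_div; apply: regular_onM; exact: equation_compat.
by exists (Cartier h0 h1).
Qed.

Lemma cartier_terms (c : {set ray X} -> k) (m : {set ray X} -> 'rV[int]_n) :
  (forall s, s \in cones X -> c s != 0) ->
  (forall s t, s \in cones X -> t \in cones X ->
     dual_cone (s :&: t) (m s - m t)) ->
  exists D, forall s, s \in cones X ->
    equation D s = ratcst n (c s) * ratmon k (m s).
Proof.
move=> c0 mst.
pose f s := ratcst n (c s) * ratmon k (m s).
have h0 s : s \in cones X -> f s != 0.
  by move=> sX; rewrite mulf_neq0 ?ratmon_neq0 // ratcst_eq0 c0.
have h1 s t : s \in cones X -> t \in cones X ->
    regular_on (s :&: t) (f s / f t).
  move=> sX tX; rewrite /f -mulf_div -ratmonB.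
  have ct0 : ratcst n (c t) != 0 by rewrite ratcst_eq0 c0.
  have -> : ratcst n (c s) / ratcst n (c t) = ratcst n (c s / c t).
    by apply: (mulIf ct0); rewrite divfK // -ratcstM divfK // c0.
  exact/regular_on_term/mst.
by exists (Cartier h0 h1).
Qed.

(** Local equations that are units give an effective divisor with empty support, so the axiom on
    proper intersections applies with no points. *)
Lemma dot_unit (dot : cartier k X -> curve k X -> int)
    (hdot : intersection_pairing dot) D (C : curve k X)
    (c : {set ray X} -> k) (m : {set ray X} -> 'rV[int]_n) :
  (forall s, s \in cones X -> [/\ c s != 0, orthogonal_cone s (m s) &
    equation D s = ratcst n (c s) * ratmon k (m s)]) ->
  dot D C = 0.
Proof.
move=> h; have [_ _ eff] := hdot.
have sup0 x : ~ divisor_support D x.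
  rewrite /divisor_support /=; apply; have [c0 o ->] := h _ (cone_ofP x).
  split.
    apply: (@residue_local_ring _ _ _ _ _ (c (cone_of x) * chi x (m (cone_of x)))).
    apply: residueM; first exact: residue_cst.
    exact/residue_mon/orthogonal_dual.
  have -> : (ratcst n (c (cone_of x)) * ratmon k (m (cone_of x)))^-1 =
      ratcst n (c (cone_of x))^-1 * ratmon k (- m (cone_of x)).
    rewrite invfM ratmonN; congr (_ * _).
    apply: (@mulfI _ (ratcst n (c (cone_of x)))); rewrite ?ratcst_eq0 //.
    by rewrite -ratcstM !divff ?ratcst1 // ratcst_eq0.
  apply: (@residue_local_ring _ _ _ _ _
    ((c (cone_of x))^-1 * chi x (- m (cone_of x)))).
  apply: residueM; first exact: residue_cst.
  exact/residue_mon/orthogonal_dual/orthogonalN.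
have effD : effective D.
  move=> s sX; have [_ o ->] := h s sX.
  exact/regular_on_term/orthogonal_dual.
have [[_ [x Cx] _] _ _] := curveP C.
have nsub : ~ (C `<=` divisor_support D) by move=> /(_ x Cx) /sup0.
have p (i : 'I_0) : tpoint k X by case: i.
rewrite (eff D C effD nsub 0%N p (fun=> 0%N)) ?big_ord0 //.
- by case.
- by move=> y; split => [[_ /sup0]|[[]]].
- by case.
Qed.

End CartierAlgebra.

Section ToricDivisors.
Variables (k : fieldType) (b : nat -> nat -> int) (r : nat).
Local Notation X := (limit_fan b r).
Local Notation V := (@orbit_closure k b r).
Implicit Types (m : 'rV[int]_r) (eps : 'I_r -> bool) (s t : {set ray X}).
Implicit Types (rho : ray X) (x y : tpoint k X) (D : cartier k X).
Implicit Types (v : {ffun ray X -> int}).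

Lemma orthogonal_csol s m v : s \in cones X ->
  orthogonal_cone s (m - csol s v) <->
  forall rho, rho \in s -> lpairing m (gen b rho) = v rho.
Proof.
move=> sX; split => [/forall_inP o rho rs|h].
  apply/eqP; rewrite -subr_eq0; have := o rho rs.
  by rewrite lpairingDl lpairingNl [X in _ - X]csol_pairing.
apply/forall_inP => rho rs.
by rewrite lpairingDl lpairingNl [X in _ - X]csol_pairing // -h // subrr.
Qed.

Lemma toric_cartier_neq0 v s : s \in cones X -> ratmon k (csol s v) != 0.
Proof. by move=> _; apply: ratmon_neq0. Qed.

Lemma toric_cartier_compat v s t : s \in cones X -> t \in cones X ->
  regular_on (s :&: t) (ratmon k (csol s v) / ratmon k (csol t v)).
Proof.
move=> sX tX; rewrite -ratmonB; apply: regular_on_mon.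
apply/forall_inP => rho; rewrite inE => /andP[rs rt].
rewrite lpairingDl lpairingNl [X in X - _]csol_pairing //.
by rewrite [X in _ - X]csol_pairing // subrr.
Qed.

(* The divisor \sum_rho (v rho) D_rho. *)
Definition toric_cartier v : cartier k X :=
  Cartier (@toric_cartier_neq0 v) (@toric_cartier_compat v).

Variables (dot : cartier k X -> curve k X -> int).
Hypothesis hdot : intersection_pairing dot.

(** Each local equation is compared with the one on the torus, [f]: compatibility both ways makes
    the quotient a unit of the Laurent ring. So [D] is the sum of the divisor of [f], a toric
    divisor and a divisor given by units. *)
Lemma cartier_toric D :
  exists v, forall C, dot D C = dot (toric_cartier v) C.
Proof.
have [addP prinP _] := hdot.
have X0 : finset.set0 \in cones X.
  by apply/cone_sgnP; exists (fun=> true) => rho; rewrite inE.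
pose f := equation D finset.set0.
have f0 : equation D finset.set0 != 0 := equation_neq0 D X0.
have /choice [cm cmP] s : exists cm : k * 'rV[int]_r, s \in cones X ->
    cm.1 != 0 /\ equation D s = f * (ratcst r cm.1 * ratmon k cm.2).
  have [sX|nsX] := boolP (s \in cones X); last by exists (0, 0).
  have es0 : equation D s != 0 := equation_neq0 D sX.
  have [a _ ea] := equation_compat D sX X0.
  have [a' _ ea'] := equation_compat D X0 sX.
  have [|c [m [c0 e]]] := @laurent_unit _ _ a a'.
    by rewrite -ea -ea'; exact: (divf_mul_inv es0 f0).
  exists (c, m) => _; split; first exact: c0.
  by rewrite -e -ea; exact: (divf_mul_cancel _ f0).
pose c s := (cm s).1; pose m s := (cm s).2.
have c0 s : s \in cones X -> c s != 0 by case/cmP.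
have eD s : s \in cones X -> equation D s = f * (ratcst r (c s) * ratmon k (m s)).
  by case/cmP.
have mst s t : s \in cones X -> t \in cones X -> dual_cone (s :&: t) (m s - m t).
  move=> sX tX; have cc0 : c s / c t != 0 by rewrite mulf_neq0 ?invr_eq0 ?c0.
  apply: (@regular_on_dual _ _ _ _ (c s / c t)) => //.
  have := equation_compat D sX tX; rewrite !eD // -mulf_div divff // mul1r.
  rewrite -mulf_div -ratmonB.
  suff -> : ratcst r (c s) / ratcst r (c t) = ratcst r (c s / c t) by [].
  have ct0 : ratcst r (c t) != 0 by rewrite ratcst_eq0 c0.
  by apply: (mulIf ct0); rewrite divfK // -ratcstM divfK // c0.
(* The coefficient is read on the cone of the single ray; compatibility both ways gives the same
   value on every cone containing that ray. *)
pose v : {ffun ray X -> int} := [ffun rho => lpairing (m [set rho]%SET) (gen b rho)].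
have mv s rho : s \in cones X -> rho \in s -> lpairing (m s) (gen b rho) = v rho.
  move=> sX rs; have rhos : [set rho]%SET \subset s by rewrite finset.sub1set.
  have rX := cone_subset rhos sX.
  have := forall_inP (mst _ _ sX rX) rho; rewrite !inE eqxx rs => /(_ isT).
  have := forall_inP (mst _ _ rX sX) rho; rewrite !inE eqxx rs => /(_ isT).
  rewrite !lpairingDl !lpairingNl !subr_ge0 => le1 le2.
  by apply/eqP; rewrite eq_le ffunE le1 le2.
exists v => C.
have [P eP] := cartier_principal X f0.
have mo s : s \in cones X -> orthogonal_cone s (m s - csol s v).
  by move=> sX; apply/orthogonal_csol => // rho; apply: mv.
(* [E] collects the constants and the discrepancy of exponents, which is orthogonal to [s] on each
   chart. *)
have [E eE] : exists E : cartier k X, forall s, s \in cones X ->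
    equation E s = ratcst r (c s) * ratmon k (m s - csol s v).
  apply: cartier_terms => // s t sX tX.
  apply/orthogonal_dual/orthogonalD; last apply: orthogonalN.
    by apply: orthogonal_subset (mo s sX); apply: subsetIl.
  by apply: orthogonal_subset (mo t tX); apply: subsetIr.
have [F eF] := cartier_mul (toric_cartier v) E.
rewrite (addP P F D C) => [|s sX]; last first.
  rewrite eD // eP // eF // eE //= ratmonB; congr (_ * _).
  rewrite [RHS]mulrCA; congr (_ * _).
  exact: (divf_mul_cancel _ (ratmon_neq0 _ _)).
rewrite (prinP P f C) // add0r (addP (toric_cartier v) E F C) //.
rewrite (dot_unit hdot (D := E) C (c := c) (m := fun s => m s - csol s v)) ?addr0 //.
by move=> s sX; split; [apply: c0|apply: mo|apply: eE].
Qed.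

Lemma dot_toricD v v' C : dot (toric_cartier (v + v')) C =
  dot (toric_cartier v) C + dot (toric_cartier v') C.
Proof.
have [addP _ _] := hdot; apply: addP => s _ /=.
by rewrite csolD ratmonD.
Qed.

Lemma dot_toric_sum v C : dot (toric_cartier v) C =
  \sum_rho v rho * dot (toric_cartier (ray_delta rho)) C.
Proof.
pose d w := dot (toric_cartier w) C.
have dD w w' : d (w + w') = d w + d w' := dot_toricD w w' C.
have d0 : d 0 = 0 by apply: (addrI (d 0)); rewrite -dD !addr0.
have dMn w j : d (w *+ j) = d w *+ j.
  by elim: j => [|j IH]; rewrite ?mulr0n // !mulrS dD IH.
have dN w : d (- w) = - d w by apply: (addrI (d w)); rewrite -dD !subrr.
have dMz w z : d (w *~ z) = z * d w.
  case: z => j; first by rewrite -pmulrn dMn pmulrn mulrzz mulrC.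
  by rewrite NegzE mulrNz dN -pmulrn dMn pmulrn mulrzz mulNr mulrC.
have vE : v = \sum_rho ray_delta rho *~ v rho.
  apply/ffunP => rho; rewrite sum_ffunE (bigD1 rho) //= big1 ?addr0.
    by rewrite ffunMzE ffunE eqxx intz.
  by move=> rho' ne; rewrite ffunMzE ffunE eq_sym (negPf ne) mul0rz.
rewrite [in LHS]vE -/(d _) (big_morph d dD d0); apply: eq_bigr => rho _.
by rewrite dMz.
Qed.

Lemma dot_toric_character m C :
  \sum_rho lpairing m (gen b rho) * dot (toric_cartier (ray_delta rho)) C = 0.
Proof.
pose v : {ffun ray X -> int} := [ffun rho => lpairing m (gen b rho)].
have [_ prinP _] := hdot.
transitivity (dot (toric_cartier v) C).
  by rewrite dot_toric_sum; apply: eq_bigr => rho _; rewrite ffunE.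
apply: (prinP _ (ratmon k m)) => s sX /=; congr ratmon.
by apply: sol_unique => i; rewrite !mxE ffunE.
Qed.

End ToricDivisors.

(** The decomposition demanded by [local_multiplicity] with the single generator 1: a constant, a
    multiple of the equation, and an element of the ideal of the curve. *)
Lemma residue_split (F : fieldType) (h a d c p m q : F) : d != 0 -> h = a / d ->
  a + (- c) * d = p * m + q -> h = c * 1 + p / d * m + q / d.
Proof.
move=> d0 -> e; rewrite mulr1 -addrA [p / d * m]mulrAC -mulrDl -e mulrDl.
by rewrite mulfK // addrCA subrr addr0.
Qed.

(** * Intersection numbers of ray divisors with wall curves *)

Section WallIntersections.
Variables (k : fieldType) (b : nat -> nat -> int) (r : nat).
Local Notation X := (limit_fan b r).
Local Notation V := (@orbit_closure k b r).
Implicit Types (m : 'rV[int]_r) (eps : 'I_r -> bool) (s t : {set ray X}).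
Implicit Types (rho : ray X) (x y : tpoint k X).

Definition ray_divisor rho : cartier k X := toric_cartier k (ray_delta rho).

Lemma effective_ray_divisor rho : effective (ray_divisor rho).
Proof. by move=> s sX; apply/regular_on_mon/dvec_dual. Qed.

(** If [rho] is in the cone, the equation vanishes at the point, and an inverse in the local ring
    would give 1 the value 0. *)
Lemma support_ray_divisor rho x :
  divisor_support (ray_divisor rho) x <-> rho \in cone_of x.
Proof.
have xX := cone_ofP x.
have rm : residue x (ratmon k (dvec (cone_of x) rho)) (chi x (dvec (cone_of x) rho)).
  exact/residue_mon/dvec_dual.
rewrite /divisor_support /=; split => [h|rx [_ /local_ring_residue[v rv]]].
  apply/negPn/negP => rx; apply: h.
  have o : orthogonal_cone (cone_of x) (dvec (cone_of x) rho).
    by rewrite dvec_orthogonal.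
  split; first exact: residue_local_ring rm.
  rewrite -ratmonN; apply: residue_local_ring.
  exact/residue_mon/orthogonal_dual/orthogonalN.
have := residueM rm rv; rewrite divff ?ratmon_neq0 // chi_eq0 ?mul0r; last first.
  by rewrite dvec_orthogonal // rx.
rewrite -ratcst1 => /(residue_inj (residue_cst x 1))/eqP.
by rewrite oner_eq0.
Qed.

(* Locally at the fixed point, the curve and the divisor are transversal: the
   curve is cut out by all coordinates but the equation of the divisor. *)
Lemma wall_expansion eps (i : 'I_r) x (a : laurent k r) :
  cone_of x = max_cone b eps -> regular (max_cone b eps) a ->
  exists p q : laurent k r,
    [/\ regular (max_cone b eps) p, regular (max_cone b eps) q,
        forall y, V (wall b eps i) y -> chart (max_cone b eps) y -> eval q y = 0 &
        ratfun_of a = ratcst r (eval a x) +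
          (ratfun_of p * ratmon k (dvec (max_cone b eps) (i, eps i)) + ratfun_of q)].
Proof.
move=> ex; have sX := max_coneX b eps; set s := max_cone b eps in ex sX *.
set m := dvec s (i, eps i).
have is_ : ((i, eps i) : ray X) \in s by rewrite inE.
have nil0 : ratfun_of ([::] : laurent k r) = 0 by rewrite /ratfun_of big_nil.
elim: a => [_|u a IH /andP[ud /IH[p [q [rp rq q0 aE]]]]].
  exists [::], [::]; split => //; first by move=> y; rewrite /eval big_nil.
  by rewrite nil0 /eval big_nil ratcst0 mul0r !addr0.
have evalE : eval (u :: a) x = u.1 * chi x u.2 + eval a x.
  by rewrite /eval big_cons.
(* Three kinds of characters: orthogonal to the maximal cone, hence trivial; orthogonal to the wall
   only, hence divisible by the equation of the divisor; the others, which vanish on the curve. *)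
have [o|no] := boolP (orthogonal_cone s u.2).
  exists p, q; split => //.
  rewrite ratfun_of_cons evalE aE (max_cone_orthogonal o) chi0 ratmon0 !mulr1.
  by rewrite ratcstD -[RHS]addrA.
have chi_u : chi x u.2 = 0 by rewrite chi_eq0 // ex.
rewrite ratfun_of_cons evalE aE chi_u mulr0 add0r addrCA.
have [ow|now] := boolP (orthogonal_cone (wall b eps i) u.2).
  (* The exponent stays in the dual cone because [u.2] takes a positive integer value on
     [(i, eps i)]. *)
  exists ((u.1, u.2 - m) :: p), q; split => //.
    rewrite /regular /= -/(regular s p) rp andbT.
    apply/forall_inP => rho rs; rewrite lpairingDl lpairingNl.
    rewrite [X in _ - X]dvec_pairing //.
    have [e|ne] := eqVneq rho (i, eps i).
      have := forall_inP ud rho rs; rewrite le_eqVlt => /orP[|lt].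
        rewrite eq_sym => /eqP z; case/negP: no; apply/forall_inP => -[j f] rs'.
        have [ji|ji] := eqVneq j i.
          move: rs'; rewrite inE /= ji => /eqP ->; rewrite -e; exact/eqP.
        apply: (forall_inP ow); rewrite inE /= ji andbT.
        by move: rs'; rewrite inE.
      rewrite subr_ge0; exact: lt.
    by rewrite subr0; apply: (forall_inP ud).
  rewrite ratfun_of_cons ratmonB; congr (_ + _).
  rewrite mulrDl -[RHS]addrA; congr (_ + _).
  by rewrite -mulrA divfK ?ratmon_neq0.
exists p, (u :: q); split => //; first by rewrite /regular /= ud.
  move=> y wy sy; rewrite /eval big_cons -/(eval q y) q0 // addr0.
  rewrite chi_eq0 ?mulr0 //; apply: contra now; exact: orthogonal_subset.
by rewrite ratfun_of_cons; congr (_ + _); rewrite addrCA.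
Qed.

(** The local quotient is the ground field: the value at the point makes the constant unique, and
    [wall_expansion] provides the rest of the decomposition. *)
Lemma wall_multiplicity eps (i : 'I_r) x : cone_of x = max_cone b eps ->
  local_multiplicity (ray_divisor (i, eps i)) (V (wall b eps i)) x 1.
Proof.
move=> ex; have sX := max_coneX b eps.
have Vx : V (wall b eps i) x by rewrite /orbit_closure /= ex wall_sub.
set s := max_cone b eps in ex sX *.
pose m := dvec s (i, eps i).
have eqE : equation (ray_divisor (i, eps i)) (cone_of x) = ratmon k m by rewrite ex.
have res1 : residue x 1 1 by rewrite -ratcst1; apply: residue_cst.
have resm : residue x (ratmon k m) 0.
  have -> : 0 = chi x m.
    by rewrite chi_eq0 // ex dvec_orthogonal // inE eqxx.
  by apply: residue_mon; rewrite ex; apply: dvec_dual.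
exists (fun=> 1) => [_|h]; first exact: residue_local_ring res1.
rewrite eqE => -[a [d [ra rd d0 hE]]].
set c := eval a x / eval d x.
have resh : residue x h c by exists a, d; rewrite divfK.
exists [ffun=> c]; split; last first.
  move=> c' [p [q [/local_ring_residue[v rv] /(local_ideal_residue Vx) rq hE']]].
  have := residueD (residueD (residueM (residue_cst x (c' ord0)) res1)
    (residueM rv resm)) rq.
  rewrite big_ord1 in hE'; rewrite -hE' mulr0 !addr0 mulr1.
  move=> /(residue_inj resh) cE.
  by apply/ffunP => j; rewrite ffunE [j]ord1; exact: cE.
rewrite ex in ra rd.
(* Numerator of [h - c], where [c] is the value of [h] at [x]. *)
pose q0 := a ++ lscale (- c) d.
have rq0 : regular s q0 by rewrite regular_cat regular_scale ra.
have [p [q [rp rq qV qE]]] := wall_expansion i ex rq0.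
have q00 : eval q0 x = 0.
  by rewrite eval_cat eval_scale mulNr /c divfK // subrr.
rewrite q00 ratcst0 add0r ratfun_of_cat ratfun_of_scale ratcstN in qE.
exists (ratfun_of p / ratfun_of d), (ratfun_of q / ratfun_of d); split.
- by exists p, d; rewrite ex.
- by exists q, d; rewrite ex.
- rewrite big_ord1 ffunE; exact: (residue_split (ratfun_of_neq0 d0) hE qE).
Qed.

Variables (dot : cartier k X -> curve k X -> int).
Hypothesis hdot : intersection_pairing dot.

Lemma wall_proper eps (i : 'I_r) rho : rho \notin wall b eps i ->
  ~ (V (wall b eps i) `<=` divisor_support (ray_divisor rho)).
Proof.
move=> rw h; have [x ex] := tpoint_of k (wallX b eps i).
have /h/support_ray_divisor : V (wall b eps i) x.
  by rewrite /orbit_closure /= ex.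
by rewrite ex (negPf rw).
Qed.

(** The two rays of one index never share a cone, so the divisor misses the curve. *)
Lemma dot_wall_opposite (C : curve k X) eps (i : 'I_r) rho :
  carrier C = V (wall b eps i) -> rho.1 != i -> rho.2 != eps rho.1 ->
  dot (ray_divisor rho) C = 0.
Proof.
move=> CE ri re; have [_ _ eff] := hdot.
have rw : rho \notin wall b eps i by rewrite inE (negPf re).
have nsub : ~ (C `<=` divisor_support (ray_divisor rho)).
  by rewrite CE; apply: wall_proper.
have p (j : 'I_0) : tpoint k X by case: j.
rewrite (eff _ C (@effective_ray_divisor rho) nsub 0%N p (fun=> 0%N)) ?big_ord0 //.
- by case.
- move=> y; split => [[Cy /support_ray_divisor ry]|[[]] //].
  have /fintype.subsetP/(_ (rho.1, eps rho.1)) : V (wall b eps i) y by rewrite -CE.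
  rewrite inE eqxx ri => /(_ isT) /(cone_sgn (cone_ofP y)) /= e.
  by have := cone_sgn (cone_ofP y) ry; rewrite -e => /eqP; rewrite (negPf re).
- by case.
Qed.

Lemma dot_wall_transversal (C : curve k X) eps (i : 'I_r) e :
  carrier C = V (wall b eps i) -> dot (ray_divisor (i, e)) C = 1.
Proof.
(* The wall ignores the sign at [i], which may therefore be taken to be [e]; the only common point
   is the fixed point of [eps']. *)
pose eps' := set_sign eps i e; rewrite -(wall_set_sign b eps i e) -/eps' => CE.
have -> : (i, e) = (i, eps' i) by rewrite /eps' /set_sign eqxx.
have [_ _ eff] := hdot.
have nsub : ~ (C `<=` divisor_support (ray_divisor (i, eps' i))).
  by rewrite CE; apply: wall_proper; rewrite inE /= !eqxx.
have [x ex] := tpoint_of k (max_coneX b eps').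
rewrite (eff _ C (@effective_ray_divisor (i, eps' i)) nsub 1%N (fun=> x) (fun=> 1%N)).
- by rewrite big_ord1.
- by move=> j l _; rewrite !ord1.
- move=> y; split => [[Cy /support_ray_divisor ry]|[_ ->]].
    exists ord0; apply: max_cone_point_eq ex; rewrite -orbit_closure_max.
    apply/fintype.subsetP => -[j f]; rewrite inE /= => /eqP ->.
    have [->//|ji] := eqVneq j i.
    have /fintype.subsetP : V (wall b eps' i) y by rewrite -CE.
    by apply; rewrite inE eqxx.
  split; last by apply/support_ray_divisor; rewrite ex inE.
  by rewrite CE /orbit_closure /= ex wall_sub.
- by move=> _; rewrite CE; apply: wall_multiplicity.
Qed.

Lemma dot_ray_relation (C : curve k X) (j : 'I_r) :
  dot (ray_divisor (j, true)) C = dot (ray_divisor (j, false)) C +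
    \sum_(l < r | (l < j)%N) b l j * dot (ray_divisor (l, false)) C.
Proof.
pose F (l : 'I_r) (e : bool) : int :=
  gen b (l, e) 0 j * dot (ray_divisor (l, e)) C.
have F0 : \sum_l \sum_e F l e = 0.
  rewrite pair_bigA -[RHS](dot_toric_character hdot (delta_mx 0 j) C).
  apply: eq_bigr => -[l e] _; congr (_ * _); rewrite /lpairing (bigD1 j) //=.
  rewrite mxE !eqxx mul1r big1 ?addr0 // => i ij.
  by rewrite mxE (negPf ij) mul0r.
have Ft : \sum_l F l true = dot (ray_divisor (j, true)) C.
  rewrite (bigD1 j) //= /F gen_entry eqxx mul1r big1 ?addr0 // => l lj.
  by rewrite gen_entry (negPf lj) mul0r.
have Ff : \sum_l F l false = - dot (ray_divisor (j, false)) C -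
    \sum_(l < r | (l < j)%N) b l j * dot (ray_divisor (l, false)) C.
  rewrite [X in _ - X]big_mkcond -sumrN.
  rewrite (bigD1 j) //= [X in _ = _ + X](bigD1 j) //= ltnn oppr0 add0r.
  rewrite /F gen_entry eqxx ltnn subr0 mulN1r; congr (_ + _).
  apply: eq_bigr => l lj; rewrite gen_entry (negPf lj) oppr0 sub0r.
  by case: ifP => _; rewrite ?mulNr // oppr0 mul0r.
move: F0; under eq_bigr do rewrite big_bool /=.
rewrite big_split /= Ft Ff -opprD => /subr0_eq; exact.
Qed.

End WallIntersections.

(** * The generators *)

Section IndexSequence.
Variables (r : nat) (b : nat -> nat -> int).

Variant next_index_spec (p : pred nat) (j : nat) : option nat -> Prop :=
| NextIndexSome l of (j < l < r)%N & p l &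
    (forall l', (j < l' < l)%N -> ~~ p l') : next_index_spec p j (Some l)
| NextIndexNone of (forall l, (j < l < r)%N -> ~~ p l) :
    next_index_spec p j None.

Lemma next_indexP p j : next_index_spec p j (next_index r p j).
Proof.
(* The scan may start at any [m]; [maxn] covers a start beyond [r], where no candidate is left. *)
suff H d m : (m + d)%N = maxn m r -> (j < m)%N ->
    (forall l, (j < l < m)%N -> ~~ p l) ->
    next_index_spec p j (ohead [seq l <- iota m d | p l]).
  by apply: H => // [|l]; lia.
elim: d m => [|d IH] m md jm hm /=.
  by apply: NextIndexNone => l lr; apply: hm; lia.
case: ifPn => pm; first by apply: NextIndexSome => //; lia.
apply: IH => [||l lm]; [lia|lia|].
by have [->//|ne] := eqVneq l m; apply: hm; lia.
Qed.

Lemma index_tail_gt fuel j a :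
  all (fun l => j < l)%N (index_tail fuel r b j a).
Proof.
elim: fuel j a => //= fuel IH j a; case: next_indexP => //= l lr _ _.
have jl : (j < l)%N by case/andP: lr.
rewrite jl /=; apply: sub_all (IH l _) => l'; exact: ltn_trans.
Qed.

(** Starting from the row [- b i l] makes the choice of the second index an instance of the general
    step, so a single recursion covers the sequence; the extra fuel pays for that step. *)
Lemma index_seqE i :
  index_seq r b i = i :: index_tail r.+1 r b i (fun l => - b i l).
Proof.
rewrite /index_seq /=; congr (_ :: _).
have -> : next_index r (fun l => - b i l < 0) i =
    next_index r (fun l => 0 < b i l) i.
  by congr ohead; apply: eq_filter => l; rewrite oppr_lt0.
case: next_index => // j; congr (_ :: index_tail _ _ _ _ _).
by apply/funext => l; rewrite opprK.
Qed.

(* The row a carried by the recursion records minus the contribution of the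
   indices up to j to the coefficient of e_l^+ in the wall relation. *)
Lemma index_tail_nonpos fuel j a (xp xm : nat -> int) :
  (r <= fuel + j)%N ->
  (forall l, (j < l < r)%N ->
     xp l = xm l - a l + \sum_(j.+1 <= q < l) b q l * xm q) ->
  (forall l, (j < l < r)%N -> l \in index_tail fuel r b j a -> xp l = 0) ->
  (forall l, (j < l < r)%N -> l \notin index_tail fuel r b j a -> xm l = 0) ->
  forall l, (j < l < r)%N -> xp l <= 0 /\ xm l <= 0.
Proof.
elim: fuel j a => [|fuel IH] j a; first by move=> rj _ _ _ l; lia.
move=> rf rel /=; case: next_indexP => [j' /andP[jj' j'r] aj' nj'|na] inI outI.
  have gt := index_tail_gt fuel j' (fun l => - a j' * b j' l + a l).
  set I := index_tail _ _ _ _ _ in gt inI outI *.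
  have notI l : (l < j')%N -> l \notin j' :: I.
    move=> lj; rewrite in_cons negb_or ltn_eqF //=; apply/negP => /(allP gt).
    by rewrite ltnNge (ltnW lj).
  have xm0 l : (j < l < j')%N -> xm l = 0.
    by move=> /andP[jl lj]; apply: outI (notI _ lj); rewrite jl (ltn_trans lj).
  have sum0 m l : (m <= j')%N -> \sum_(j.+1 <= q < m) b q l * xm q = 0.
    move=> mj; rewrite big_nat big1 // => q /andP[jq qm].
    by rewrite xm0 ?mulr0 // jq (leq_trans qm).
  have xpj' : xp j' = 0 by apply: inI; rewrite ?mem_head // jj'.
  (* At a selected index [xp] vanishes, and the relation leaves [a j'], negative by the choice of
     [j']. *)
  have xmj' : xm j' = a j'.
    have := rel j'; rewrite jj' j'r sum0 // addr0 xpj' => /(_ isT)/esym/eqP.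
    by rewrite subr_eq0 => /eqP.
  (* Before [j'] no entry of [a] is negative and [xp l = - a l]; after [j'] the new row absorbs the
     term [b j' l * xm j']. *)
  move=> l /andP[jl lr]; case: (ltngtP l j') => [lj|jl'|->].
  - rewrite xm0 ?jl //; split => //.
    have lr' : (j < l < r)%N by rewrite jl.
    rewrite rel // xm0 ?jl // sum0 ?(ltnW lj) // addr0 sub0r oppr_le0.
    by have := nj' l; rewrite jl lj leNgt => /(_ isT).
  - apply: (IH j' (fun l => - a j' * b j' l + a l)); last by rewrite jl'.
    + by lia.
    + move=> l' /andP[jl'' l'r]; rewrite rel ?(ltn_trans jj') //.
      rewrite (big_cat_nat _ (n := j')) ?(ltnW jl'') //= sum0 // add0r.
      rewrite big_ltn // xmj'; set S := \sum_(_ <= _ < _) _.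
      by rewrite mulNr; lia.
    + move=> l' /andP[jl'' l'r] l'I; apply: inI; first by rewrite (ltn_trans jj').
      by rewrite in_cons l'I orbT.
    + move=> l' /andP[jl'' l'r] l'I; apply: outI; first by rewrite (ltn_trans jj').
      by rewrite in_cons negb_or l'I gtn_eqF.
  - by rewrite xpj' xmj'; split => //; apply: ltW.
have xm0 l : (j < l < r)%N -> xm l = 0 by move=> jl; apply: outI.
move=> l jlr; rewrite xm0 //; split => //.
rewrite rel // xm0 // sub0r big_nat big1 ?addr0 => [|q /andP[jq ql]].
  by rewrite oppr_le0 leNgt na.
by rewrite xm0 ?mulr0 // jq; case/andP: jlr => _; apply: ltn_trans.
Qed.

End IndexSequence.

(** * Triangularity, the basis and the cone *)

Section Assembly.
Variables (k : fieldType) (b : nat -> nat -> int) (r : nat).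
Hypothesis kinf : forall l : seq k, exists z, z \notin l.
Local Notation X := (limit_fan b r).
Local Notation V := (@orbit_closure k b r).
Variables (dot : cartier k X -> curve k X -> int).
Hypothesis hdot : intersection_pairing dot.
Implicit Types (C : curve k X) (l i : 'I_r) (e : bool).

Definition ray_dot C l e : int := dot (ray_divisor k ((l, e) : ray X)) C.

Lemma ray_dotE C l :
  ray_dot C l true = ray_dot C l false +
    \sum_(q < r | (q < l)%N) b q l * ray_dot C q false.
Proof. exact: dot_ray_relation. Qed.

(** One divisor of index [l] misses the curve, and it differs from the other by terms of smaller
    index, which vanish by induction. *)
Lemma wall_ray_dot_lt C eps i : carrier C = V (wall b eps i) ->
  forall l e, (l < i)%N -> ray_dot C l e = 0.
Proof.
move=> CE l e; have [d] := ubnP l; elim: d l e => // d IH l e ld li.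
have eq0 : ray_dot C l true = ray_dot C l false.
  rewrite ray_dotE big1 ?addr0 // => q ql.
  by rewrite IH ?mulr0 //; [apply: leq_trans ql ld|apply: ltn_trans li].
have opp0 : ray_dot C l (~~ eps l) = 0.
  apply: (dot_wall_opposite hdot CE) => /=; last by case: (eps l).
  by rewrite -val_eqE /= (ltn_eqF li).
by move: opp0; case: (eps l) e => [] []; rewrite /= ?eq0.
Qed.

Lemma cycle_dotE (A : nzRingType) (D : cartier k X) (z : cycle1 k X A) :
  cycle_dot dot D z = \sum_(t <- z) t.1 *~ dot D t.2.
Proof. by apply: eq_bigr => t _; rewrite mulrzr. Qed.

(** Every divisor has the numbers of a toric one, and [ray_dotE] expresses the divisor of
    [(l, true)] through those of [(q, false)] with [q <= l]. *)
Lemma num_equiv_ray (A : nzRingType) (z z' : cycle1 k X A) :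
  num_equiv dot z z' <-> forall l,
    cycle_dot dot (ray_divisor k ((l, false) : ray X)) z =
    cycle_dot dot (ray_divisor k ((l, false) : ray X)) z'.
Proof.
split => [h l|h D]; first exact: h.
have ht l : cycle_dot dot (ray_divisor k ((l, true) : ray X)) z =
    cycle_dot dot (ray_divisor k ((l, true) : ray X)) z'.
  suff H (y : cycle1 k X A) : cycle_dot dot (ray_divisor k ((l, true) : ray X)) y =
      cycle_dot dot (ray_divisor k ((l, false) : ray X)) y +
      \sum_(q < r | (q < l)%N)
        cycle_dot dot (ray_divisor k ((q, false) : ray X)) y *~ b q l.
    by rewrite !H h; congr (_ + _); apply: eq_bigr => q _; rewrite h.
  rewrite cycle_dotE.
  under [X in _ = _ + X]eq_bigr do rewrite cycle_dotE mulrz_suml.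
  rewrite exchange_big cycle_dotE -big_split /=; apply: eq_bigr => t _.
  rewrite [dot _ _](ray_dotE t.2 l) mulrzDr mulrz_sumr; congr (_ + _).
  by apply: eq_bigr => q _; rewrite -mulrzA mulrC.
have [v vD] := cartier_toric hdot D.
have H (y : cycle1 k X A) : cycle_dot dot D y =
    \sum_(rho : ray X) cycle_dot dot (ray_divisor k rho) y *~ v rho.
  rewrite cycle_dotE.
  under [RHS]eq_bigr do rewrite cycle_dotE mulrz_suml.
  rewrite exchange_big /=; apply: eq_bigr => t _.
  rewrite vD dot_toric_sum // mulrz_sumr.
  by apply: eq_bigr => rho _; rewrite -mulrzA mulrC.
by rewrite !H; apply: eq_bigr => -[l []] _; rewrite ?ht ?h.
Qed.

Section Generators.
Variable L : 'I_r -> curve k X.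
Hypothesis LE : forall i, carrier (L i) = @curve_of k b (index_seq r b i) r.

Lemma index_curve_wall i :
  @curve_of k b (index_seq r b i) r =
  V (wall b (fun l : 'I_r => nat_of_ord l \notin index_seq r b i) i).
Proof.
have := index_tail_gt r b r.+1 i (fun q => - b i q); rewrite index_seqE => gt.
rewrite (curve_of_wall _ _ (ltn_ord i) gt); congr (V (wall _ _ _)).
exact: val_inj.
Qed.

Lemma generator_wall i :
  carrier (L i) = V (wall b (fun l : 'I_r => nat_of_ord l \notin index_seq r b i) i).
Proof. by rewrite LE index_curve_wall. Qed.

Lemma generator_lt i l e : (l < i)%N -> ray_dot (L i) l e = 0.
Proof. exact: (wall_ray_dot_lt (generator_wall i)). Qed.

Lemma generator_diag i e : ray_dot (L i) i e = 1.
Proof. exact: (dot_wall_transversal hdot e (generator_wall i)). Qed.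

Lemma generator_gt i l e : (i < l)%N -> ray_dot (L i) l e <= 0.
Proof.
move=> il.
(* Extension by 0 out of range, since the index recursion works with functions on [nat]. *)
pose x e' (q : nat) : int := oapp (fun o => ray_dot (L i) o e') 0 (insub q).
have xE e' (q : 'I_r) : x e' q = ray_dot (L i) q e' by rewrite /x valK.
have rel (q : nat) : (i < q < r)%N -> x true q =
    x false q - - b i q + \sum_(i.+1 <= q' < q) b q' q * x false q'.
  case/andP => iq qr; have -> : q = Ordinal qr by [].
  rewrite !xE ray_dotE opprK -addrA; congr (_ + _).
  (* Indices below [i] contribute nothing, and [i] itself contributes [b i q], minus the entry of
     the initial row. *)
  transitivity (\sum_(0 <= q' < q) b q' q * x false q').
    rewrite big_mkord (big_ord_widen r (fun q' => b q' q * x false q') (ltnW qr)).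
    by apply: eq_bigr => q' _; rewrite xE.
  rewrite (big_cat_nat _ (n := i)) ?(ltnW iq) //=.
  rewrite big_nat big1 ?add0r => [|q' /andP[_ q'i]]; last first.
    have q'r : (q' < r)%N by apply: ltn_trans q'i _.
    by rewrite -[q']/(nat_of_ord (Ordinal q'r)) xE generator_lt ?mulr0.
  by rewrite big_ltn // xE generator_diag mulr1.
have I0 e' q : (i < q < r)%N -> (q \notin index_seq r b i) = ~~ e' -> x e' q = 0.
  move=> /andP[iq qr] qI; have -> : q = Ordinal qr by [].
  rewrite xE; apply: (dot_wall_opposite hdot (generator_wall i)) => /=.
    by rewrite -val_eqE /= gtn_eqF.
  by rewrite qI; case: (e').
have [||||] := @index_tail_nonpos r b r.+1 i (fun q => - b i q) (x true) (x false)
  _ rel _ _ l.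
- by lia.
- move=> q iq qI; apply: I0 => //; rewrite index_seqE in_cons qI orbT; done.
- move=> q iq qI; apply: I0 => //; rewrite index_seqE in_cons negb_or qI andbT.
  by case/andP: iq => iq _; rewrite gtn_eqF.
- by rewrite il ltn_ord.
by rewrite !xE; case: e.
Qed.

Lemma cycle_dot_combination (A : nzRingType) (a : 'I_r -> A) D :
  cycle_dot dot D (combination a L) = \sum_i a i *~ dot D (L i).
Proof. by rewrite cycle_dotE big_map big_enum. Qed.

Lemma generators_basis : classes_form_basis dot L.
Proof.
pose M : 'M[int]_r := \matrix_(i, l) ray_dot (L i) l false.
have Mu : M \in unitmx.
  rewrite -unitmx_tr unitmxE det_trig.
    by rewrite big1 ?unitr1 // => i _; rewrite !mxE generator_diag.
  by apply/is_trig_mxP => i j ij; rewrite !mxE generator_lt.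
move=> z; pose v : 'rV[int]_r :=
  \row_l cycle_dot dot (ray_divisor k ((l, false) : ray X)) z.
(* The coefficients of a cycle solve a linear system over the integers, whose matrix is invertible
   there because its determinant is 1. *)
have equivP (a : {ffun 'I_r -> int}) :
    num_equiv dot z (combination a L) <-> (\row_i a i) *m M = v.
  split => [/num_equiv_ray h|e].
    apply/rowP => l; rewrite !mxE h cycle_dot_combination.
    by apply: eq_bigr => i _; rewrite !mxE mulrzz.
  apply/num_equiv_ray => l; have := congr1 (fun u : 'rV_r => u 0 l) e.
  rewrite !mxE => <-; rewrite cycle_dot_combination.
  by apply: eq_bigr => i _; rewrite !mxE mulrzz.
exists [ffun i => (v *m invmx M) 0 i]; split.
  apply/equivP; rewrite -[RHS](mulmxKV Mu); congr (_ *m _).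
  by apply/rowP => i; rewrite mxE ffunE.
move=> a /equivP e; apply/ffunP => i; rewrite ffunE -e mulmxK //.
by rewrite mxE.
Qed.

Lemma wall_class_nonneg C (y : 'I_r -> int) eps (i0 : 'I_r) :
  carrier C = V (wall b eps i0) ->
  (forall l e, ray_dot C l e = \sum_i y i * ray_dot (L i) l e) ->
  forall l, 0 <= y l.
Proof.
move=> CE yE l; have [d] := ubnP l; elim: d l => // d IH l ld.
(* At [i0] either sign gives 1; elsewhere the divisor of the sign absent from the wall gives 0. *)
have [e xe] : exists e, 0 <= ray_dot C l e.
  have [->|li] := eqVneq l i0.
    by exists true; rewrite /ray_dot (dot_wall_transversal hdot true CE).
  exists (~~ eps l); rewrite /ray_dot (dot_wall_opposite hdot CE) //=.
  by case: (eps l).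
apply: le_trans xe _; rewrite yE (bigD1 l) //= generator_diag mulr1.
rewrite gerDl sumr_le0 // => i il.
have [lt|le] := ltnP i l.
  by rewrite mulr_ge0_le0 ?generator_gt // IH // (leq_trans lt).
by rewrite generator_lt ?mulr0 // ltn_neqAle le eq_sym val_eqE il.
Qed.

(** The real coefficients are the images of the integral coordinates of the class, whose signs are
    settled over the integers. *)
Lemma torus_invariant_in_cone (R : realType) C :
  torus_invariant C -> class_in_cone R dot L C.
Proof.
move=> /(torus_invariant_curve kinf)[eps [i0 CE]].
have [y [yC _]] := generators_basis [:: (1, C)].
have dotE D : dot D C = \sum_i y i * dot D (L i).
  have := yC D; rewrite cycle_dot_combination cycle_dotE big_seq1 /= => e.
  by rewrite -[LHS]intz e; apply: eq_bigr => i _; rewrite mulrzz.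
have y0 := wall_class_nonneg CE (fun l e => dotE (ray_divisor k ((l, e) : ray X))).
exists (fun i => (y i)%:~R) => [i|D]; first by rewrite ler0z.
rewrite cycle_dot_combination cycle_dotE big_seq1 /= dotE mulrz_sumr.
by apply: eq_bigr => i _; rewrite mulrzA.
Qed.

End Generators.

Lemma generators_exist : exists L : 'I_r -> curve k X,
  forall i, carrier (L i) = @curve_of k b (index_seq r b i) r.
Proof.
have curveL i : is_curve (@curve_of k b (index_seq r b i) r).
  by rewrite index_curve_wall; apply: wall_curve.
by exists (fun i => Curve (curveL i)).
Qed.

End Assembly.

Unset Implicit Arguments.
Local Close Scope classical_set_scope.

(* w lists the simple roots beta_1, ..., beta_r, and C is R[i]. *)
Theorem theorem7p8 (R : realType) (n : nat) (A : 'M[int]_n)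
    (hA : generalized_cartan A) (w : seq 'I_n)
    (dot : cartier R[i] (toric_limit A w) -> curve R[i] (toric_limit A w) ->
           int)
    (hdot : intersection_pairing dot) :
  exists L : 'I_(size w) -> curve R[i] (toric_limit A w),
    [/\ forall i, carrier (L i) =
          @curve_of R[i] (word_coef A w)
            (index_seq (size w) (word_coef A w) i) (size w),
        classes_form_basis dot L &
        forall C : curve R[i] (toric_limit A w),
          torus_invariant C -> class_in_cone R dot L C].
Proof.
have Cinf (l : seq R[i]) : exists z, z \notin l.
  (* One more natural number than [l] has entries; they are distinct in characteristic 0. *)
  pose s : seq R[i] := [seq m%:R | m <- iota 0 (size l).+1].
  have us : uniq s.
    rewrite map_inj_uniq ?iota_uniq // => m m' /eqP.
    by rewrite eqr_nat => /eqP.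
  apply: contrapT => /forallNP h.
  have /(uniq_leq_size us) : {subset s <= l}.
    by move=> z _; apply/negPn/negP; apply: h.
  by rewrite size_map size_iota ltnn.
have [L LE] := generators_exist (word_coef A w) (size w) Cinf.
exists L; split => // [|C tC].
  exact: generators_basis.
exact: torus_invariant_in_cone.
Qed.
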